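(* Suppose $a_k=1$, $a_j\in C^{0,\alpha}(\mathbb I)$ for $j=0,1,\ldots,k-1$, and $f\in C^{0,\alpha}(\mathbb I)$, with $\alpha>0$. Suppose that, with the imposed boundary conditions, both the leading-order operator equation (i.e. the boundary-value problem (BVP) with $a_j$ replaced by $0$ for $j=0,\dots,k-1$) and the full boundary-value problem (BVP) are uniquely solvable. If the nodes $P=P_{N-k}$ (a set of $N-k$ distinct points in $\mathbb I$ for each $N$) have Lebesgue constants satisfying $\|\mathcal I^{P}_{N-k}\|_\infty=o(\min\{N^{\alpha},N^{1/2}\})$ as $N\to\infty$, then for $N$ sufficiently large the collocation method (C) using the nodes $P_{N-k}$ produces a solution $u_N$ that converges to the true solution $u$ of (BVP), and there is a constant $C$ independent of $N$ with $$\|u_N-u\|_{H^k(\mathbb I)}\le C\,\big\|u^{(k)}-\mathcal I^{P}_{N-k}u^{(k)}\big\|_{L^2(\mathbb I)}.$$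
   Context: $\mathbb I=[-1,1]$. $C^{0,\alpha}(\mathbb I)$, $0<\alpha\le1$, is the space of complex-valued $\alpha$-Hölder functions. $H^k(\mathbb I)$ is the Sobolev space with norm $\|g\|_{H^k}^2=\sum_{\ell=0}^k\|g^{(\ell)}\|_{L^2(\mathbb I)}^2$. (BVP): for $k\ge1$, $\mathbf S,\mathbf T\in\mathbb C^{k\times k}$, $\mathbf b\in\mathbb C^k$, $\sum_{j=0}^ka_j(x)u^{(j)}(x)=f(x)$ on $(-1,1)$, with $\mathbf S(u(-1),u'(-1),\dots,u^{(k-1)}(-1))^T+\mathbf T(u(1),u'(1),\dots,u^{(k-1)}(1))^T=\mathbf b$. It is called uniquely solvable if the only function in $H^k(\mathbb I)$ solving it with $\mathbf b=\mathbf 0$, $f=0$ is the zero function. $\mathcal I^{P}_{n}$ is the operator of polynomial interpolation (by polynomials of degree at most $n-1$) at $n$ distinct nodes $P$ in $\mathbb I$, and $\|\mathcal I^P_n\|_\infty$ is its operator norm on $C(\mathbb I)$ with the max norm (the Lebesgue constant). Let $\lambda\ge0$ and let $p_j(x;\lambda)$ be the orthonormal polynomials ($\deg p_j=j$) for the probability measure on $\mathbb I$ with density proportional to $(1-x^2)^{\lambda-1/2}$. Collocation method (C), for $N>k$ with nodes $P_{N-k}=(x_1,\dots,x_{N-k})$: solve the $N\times N$ linear system for $(\tilde u_0,\dots,\tilde u_{N-1})$ expressing that $u_N(x)=\sum_{i=0}^{N-1}\tilde u_ip_i(x;\lambda)$ satisfies the boundary conditions of (BVP) exactly and satisfies $\sum_{j=0}^ka_j(x_r)u_N^{(j)}(x_r)=f(x_r)$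 for $r=1,\dots,N-k$. *)

(* Defs.v *)
From HB Require Import structures.
From mathcomp Require Import all_boot all_order all_algebra.
From mathcomp Require Import all_classical all_reals all_analysis.
From mathcomp Require Import complex.
Set Implicit Arguments.
Unset Strict Implicit.
Unset Printing Implicit Defensive.
Import Order.TTheory GRing.Theory Num.Theory.
Import numFieldNormedType.Exports.
Local Open Scope classical_set_scope.
Local Open Scope ring_scope.
Local Open Scope complex_scope.

Definition mu {R : realType} := @lebesgue_measure R.

Definition II {R : realType} : set R := `[-1, 1]%classic.

(* Complex-valued functions on [-1, 1] are total functions [R -> R[i]] of which
   only the restriction to [II] matters. *)

(* [normc z : R] is the modulus; the generic norm [`|z|] lives in [R[i]]. *)
Notation normc := ComplexField.Normc.normc.
Notation Re := complex.Re.
Notation Im := complex.Im.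

Definition cts {R : realType} (g : R -> R[i]) : Prop :=
  {within II, continuous (g : R -> R[i]^o)}.

Definition hoelder_fun {R : realType} (alpha : R) (g : R -> R[i]) : Prop :=
  exists K : R, forall x y : R, II x -> II y ->
    normc (g x - g y) <= K * `|x - y| `^ alpha.

Definition supnorm {R : realType} (g : R -> R[i]) : R :=
  sup [set normc (g x) | x in II].

Definition cintegral {R : realType} (g : R -> R[i]) : R[i] :=
  (\int[mu]_(x in II) Re (g x)) +i* (\int[mu]_(x in II) Im (g x)).

Definition L2_fun {R : realType} (g : R -> R[i]) : Prop :=
  [/\ measurable_fun II (fun x => Re (g x)),
      measurable_fun II (fun x => Im (g x)) &
      (\int[mu]_(x in II) ((normc (g x) ^+ 2)%:E) < +oo)%E].

Definition L2norm {R : realType} (g : R -> R[i]) : R :=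
  Num.sqrt (\int[mu]_(x in II) (normc (g x) ^+ 2)).

(* [C^1] functions with compact support in the open interval (-1, 1). *)
Definition test_fun {R : realType} (phi : R -> R) : Prop :=
  [/\ forall x, derivable phi x 1,
      continuous (derive1 phi) &
      exists a b : R, [/\ -1 < a, b < 1 &
        forall x, ~ (a <= x <= b) -> phi x = 0]].

Definition weak_derivative {R : realType} (g h : R -> R[i]) : Prop :=
  forall phi : R -> R, test_fun phi ->
    cintegral (fun x => g x * (derive1 phi x)%:C) =
    - cintegral (fun x => h x * (phi x)%:C).

(* An element of the Sobolev space H^k(-1, 1) is given together with its weak
   derivatives: [u l] is the l-th weak derivative of [u 0%N], for [l <= k].
   For [l < k] it is the representative that is continuous on [-1, 1], which is
   what gives a meaning to boundary values; [u k] is only defined up to a null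
   set. *)
Definition sobolev {R : realType} (k : nat) (u : nat -> R -> R[i]) : Prop :=
  [/\ forall l, (l <= k)%N -> L2_fun (u l),
      forall l, (l < k)%N -> weak_derivative (u l) (u l.+1) &
      forall l, (l < k)%N -> cts (u l)].

Definition Hnorm {R : realType} (k : nat) (u : nat -> R -> R[i]) : R :=
  Num.sqrt (\sum_(l < k.+1) L2norm (u l) ^+ 2).

Definition diffop {R : realType} (k : nat) (a : nat -> R -> R[i])
    (u : nat -> R -> R[i]) (x : R) : R[i] :=
  \sum_(j < k.+1) a j x * u j x.

Definition boundary_cond {R : realType} (k : nat) (S T : 'M[R[i]]_k)
    (b : 'cV[R[i]]_k) (u : nat -> R -> R[i]) : Prop :=
  S *m (\col_(j < k) u j (-1)) + T *m (\col_(j < k) u j 1) = b.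

Definition bvp_solution {R : realType} (k : nat) (a : nat -> R -> R[i])
    (S T : 'M[R[i]]_k) (b : 'cV[R[i]]_k) (f : R -> R[i])
    (u : nat -> R -> R[i]) : Prop :=
  {ae mu, forall x : R, -1 < x < 1 -> diffop k a u x = f x} /\
  boundary_cond S T b u.

Definition uniquely_solvable {R : realType} (k : nat) (a : nat -> R -> R[i])
    (S T : 'M[R[i]]_k) : Prop :=
  forall u : nat -> R -> R[i], sobolev k u ->
    bvp_solution a S T 0 (fun=> 0) u -> forall x, II x -> u 0%N x = 0.

Definition leading_coef {R : realType} (k : nat) (a : nat -> R -> R[i])
    (j : nat) (x : R) : R[i] :=
  if (j < k)%N then 0 else a j x.

(* Lagrange form of the interpolating polynomial; see [interpP]. *)
Definition interp {R : realType} (n : nat) (P : 'I_n -> R) (g : R -> R[i]) :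
    {poly R[i]} :=
  \sum_(i < n) (g (P i) *:
    \prod_(j < n | j != i)
       (((P i)%:C - (P j)%:C)^-1 *: ('X - ((P j)%:C)%:P))).

Lemma interpP {R : realType} (n : nat) (P : 'I_n -> R) (g : R -> R[i]) :
  injective P ->
  (size (interp P g) <= n)%N /\ forall i, (interp P g).[(P i)%:C] = g (P i).
Proof.
move=> Pinj; split.
  apply: (leq_trans (size_sum _ _ _)); apply/bigmax_leqP => i _.
  apply: (leq_trans (size_scale_leq _ _)).
  apply: (leq_trans (size_prod_leq _ _)).
  have szle : (\sum_(j < n | j != i)
      size (((P i)%:C - (P j)%:C)^-1 *: ('X - ((P j)%:C)%:P)%R) <=
      \sum_(j < n | j != i) 2)%N.
    apply: leq_sum => j _; apply: (leq_trans (size_scale_leq _ _)).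
    by rewrite size_XsubC.
  rewrite leq_subLR (leq_ltn_trans szle)// sum_nat_const cardC1 card_ord.
  case: n i {Pinj szle P} => [[]//|n i] /=.
  by rewrite muln2 -addnn addnS.
move=> i; rewrite /interp horner_sum (bigD1 i)//=.
rewrite [X in _ + X]big1 => [|j ji].
  rewrite addr0 hornerZ horner_prod big1 ?mulr1// => j ji.
  rewrite hornerZ hornerXsubC mulVf// subr_eq0.
  by apply: contra ji => /eqP[/Pinj ->].
rewrite hornerZ horner_prod (bigD1 i) 1?eq_sym//=.
by rewrite hornerZ hornerXsubC subrr mulr0 mul0r mulr0.
Qed.

(* Values on the real line of the l-th derivative of a polynomial. *)
Definition polyfun {R : realType} (q : {poly R[i]}) (l : nat) (x : R) : R[i] :=
  (q^`(l)).[x%:C].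

(* Operator norm of interpolation on C([-1, 1]). *)
Definition lebesgue_const {R : realType} (n : nat) (P : 'I_n -> R) : R :=
  sup [set supnorm (polyfun (interp P g) 0) |
        g in [set g : R -> R[i] | cts g /\ supnorm g <= 1]].

Definition gegenbauer_weight {R : realType} (lambda x : R) : R :=
  (1 - x ^+ 2) `^ (lambda - 2^-1).

(* The normalisation fixes [p j] only up to sign; the statement holds for every
   choice of signs. *)
Definition orthonormal_polys {R : realType} (lambda : R) (p : nat -> {poly R}) :
    Prop :=
  (forall j, size (p j) = j.+1) /\
  forall i j,
    (\int[mu]_(x in II) ((p i).[x] * (p j).[x] * gegenbauer_weight lambda x)) /
    (\int[mu]_(x in II) gegenbauer_weight lambda x) = (i == j)%:R.

Definition expansion {R : realType} (p : nat -> {poly R}) (N : nat)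
    (c : 'cV[R[i]]_N) : {poly R[i]} :=
  \sum_(i < N) c i 0 *: map_poly (real_complex R) (p i).

(* The N linear equations (k boundary rows, N - k collocation rows) satisfied by
   the coefficient vector [c]. *)
Definition collocation {R : realType} (k : nat) (a : nat -> R -> R[i])
    (S T : 'M[R[i]]_k) (b : 'cV[R[i]]_k) (f : R -> R[i])
    (p : nat -> {poly R}) (N : nat) (P : 'I_(N - k) -> R) (c : 'cV[R[i]]_N) :
    Prop :=
  boundary_cond S T b (polyfun (expansion p c)) /\
  forall r : 'I_(N - k), diffop k a (polyfun (expansion p c)) (P r) = f (P r).

(* Main.v *)
Require Import Defs.
From HB Require Import structures.
From mathcomp Require Import all_boot all_order all_algebra.
From mathcomp Require Import all_classical all_reals all_analysis.
From mathcomp Require Import complex measurable_realfun.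
From mathcomp Require Import ring lra zify.
Set Implicit Arguments.
Unset Strict Implicit.
Unset Printing Implicit Defensive.
Import Order.TTheory GRing.Theory Num.Theory.
Import numFieldNormedType.Exports.
Local Open Scope classical_set_scope.
Local Open Scope ring_scope.
Local Open Scope complex_scope.

(** Let v = u_N - u. The boundary conditions of v are homogeneous and the
    differential operator annihilates v at the nodes. Writing A v for the
    lower-order terms (all derivatives below the k-th, with coefficients a_j),
    interpolation of (v^(k) + A v) at the nodes therefore gives 0; since
    u_N^(k) is a polynomial of degree below N - k it is reproduced by
    interpolation, and one gets on the whole interval
<<
      v^(k) + A v = (A v - I(A v)) - (u^(k) - I u^(k)),
>>
    which is [collocation_residual]. Two facts close the argument.

    - Stability ([full_stability]): unique solvability bounds
      v, ..., v^(k-1) in the sup norm, and v^(k) in L2, by the L2 norm of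
      v^(k) + A v.
    - Approximation: A v is Hoelder continuous with exponent
      beta = min(alpha, 1/2) and constant controlled by the same L2 norm
      ([lower_order_hoelder]); the exponent 1/2 is Cauchy-Schwarz applied to
      v^(k-1), whose derivative is only controlled in L2. Jackson's theorem
      ([jackson]) and the Lebesgue constant then bound A v - I(A v) by
      O(Lebesgue constant * N^-beta) times that norm, a factor o(1) by
      hypothesis ([lebesgue_rate]).

    Hence the first term on the right is absorbed for large N, and the L2 norm
    of v^(k) + A v is at most 4 times that of u^(k) - I u^(k)
    ([collocation_bound]). Applied with u = 0 this estimate makes the square
    collocation system injective, hence solvable. Convergence follows
    because u^(k) = f - A u is itself Hoelder with exponent beta.

    Existence and stability for the differential equation avoid Fredholm
    theory: the initial value problem is a Volterra equation for u^(k), solved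
    by Picard iteration in an exponentially weighted sup norm
    ([ivp_exists]), and the boundary conditions reduce to a k x k matrix on a
    fundamental system, invertible by unique solvability
    ([boundary_mx_unit]). Weak derivatives enter only because smooth
    families are Sobolev ([Ck_sobolev]) and Sobolev families can be subtracted
    ([sobolevB]), which gives uniqueness among weak solutions.

    Jackson's theorem is proved without integrals, by a discrete convolution
    with the Fejer-Korovkin kernel at equispaced angles
    ([positive_kernel]). *)

Local Notation normc := ComplexField.Normc.normc.
Local Notation Re := complex.Re.
Local Notation Im := complex.Im.

(** * Modulus and continuity of complex-valued functions *)

Section Modulus.
Context {R : realType}.
Implicit Types z w : R[i].

Lemma normc_ge0 z : 0 <= normc z.
Proof. by case: z => a b; exact: sqrtr_ge0. Qed.

Lemma normc_norm z : `|z| = (normc z)%:C.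
Proof. by case: z => a b; rewrite normc_def. Qed.

Lemma normcD z w : normc (z + w) <= normc z + normc w.
Proof. exact: le_normcD. Qed.

Lemma normcB z w : normc (z - w) <= normc z + normc w.
Proof. by rewrite (le_trans (normcD _ _))// normcN. Qed.

Lemma normc_distC z w : normc (z - w) = normc (w - z).
Proof. by rewrite -normcN opprB. Qed.

Lemma normcR (x : R) : normc x%:C = `|x|.
Proof. by rewrite /= expr0n addr0 sqrtr_sqr. Qed.

Lemma normc_sqr z : normc z ^+ 2 = Re z ^+ 2 + Im z ^+ 2.
Proof. by case: z => a b; rewrite /= sqr_sqrtr// addr_ge0// sqr_ge0. Qed.

Lemma le_Re_normc z : `|Re z| <= normc z.
Proof.
rewrite -(@ler_pXn2r _ 2)// ?nnegrE ?normr_ge0 ?normc_ge0//.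
by rewrite normc_sqr real_normK ?num_real// lerDl sqr_ge0.
Qed.

Lemma le_Im_normc z : `|Im z| <= normc z.
Proof.
rewrite -(@ler_pXn2r _ 2)// ?nnegrE ?normr_ge0 ?normc_ge0//.
by rewrite normc_sqr real_normK ?num_real// lerDr sqr_ge0.
Qed.

Lemma normc_le_ReIm z : normc z <= `|Re z| + `|Im z|.
Proof.
rewrite -(@ler_pXn2r _ 2)// ?nnegrE ?addr_ge0 ?normr_ge0 ?normc_ge0//.
rewrite normc_sqr sqrrD !real_normK ?num_real//.
by rewrite lerD2r lerDl mulrn_wge0// mulr_ge0.
Qed.

Lemma normc_sum n (F : 'I_n -> R[i]) :
  normc (\sum_(i < n) F i) <= \sum_(i < n) normc (F i).
Proof.
elim/big_ind2 : _ => //; first by rewrite ComplexField.Normc.normc0.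
by move=> x1 x2 y1 y2 h1 h2; rewrite (le_trans (normcD _ _))// lerD.
Qed.

Lemma normc_eq0 z : normc z <= 0 -> z = 0.
Proof.
by move=> z0; apply: ComplexField.Normc.eq0_normc; apply/eqP; rewrite eq_le z0 normc_ge0.
Qed.

Lemma complex_eqP z w : Re z = Re w -> Im z = Im w -> z = w.
Proof. by case: z w => [a b] [c d] /= -> ->. Qed.

Lemma ReD z w : Re (z + w) = Re z + Re w. Proof. by case: z w => [? ?] []. Qed.
Lemma ImD z w : Im (z + w) = Im z + Im w. Proof. by case: z w => [? ?] []. Qed.
Lemma ReM z w : Re (z * w) = Re z * Re w - Im z * Im w.
Proof. by case: z w => [? ?] []. Qed.
Lemma ImM z w : Im (z * w) = Re z * Im w + Im z * Re w.
Proof. by case: z w => [? ?] []. Qed.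
Lemma ReMr z (y : R) : Re (z * y%:C) = Re z * y.
Proof. by rewrite ReM /= mulr0 subr0. Qed.
Lemma ImMr z (y : R) : Im (z * y%:C) = Im z * y.
Proof. by rewrite ImM /= mulr0 add0r. Qed.
Lemma ReN z : Re (- z) = - Re z. Proof. by case: z. Qed.
Lemma ImN z : Im (- z) = - Im z. Proof. by case: z. Qed.

End Modulus.

Section Continuity.
Context {R : realType}.
Implicit Types (h : R -> R) (g : R -> R[i]) (a b : R).

(** Real-valued counterpart of [cts]. *)
Definition rcts h : Prop := {within II, continuous h}.

Lemma II_itv (x : R) : II x <-> -1 <= x <= 1.
Proof. by rewrite /II /= in_itv. Qed.

(** The epsilon-delta form, uniform with that of [ctsP], to move between the
    topology on real numbers and the modulus. *)
Lemma rctsP h : rcts h <-> forall x, II x -> forall e : R, 0 < e ->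
  exists2 d : R, 0 < d & forall y, II y -> `|x - y| < d -> `|h x - h y| < e.
Proof.
split=> [/subspace_continuousP ch x Ix e e0|ch].
  have /cvgrPdist_lt/(_ e e0) := ch x Ix.
  rewrite near_withinE => /nbhs_ballP[d /= d0 dh]; exists d => // y Iy xy.
  exact: dh.
apply/subspace_continuousP => x Ix; apply/cvgrPdist_lt => e e0.
have [d d0 dh] := ch x Ix e e0.
by rewrite near_withinE; apply/nbhs_ballP; exists d => //= y xy Iy; exact: dh.
Qed.

Lemma ctsP g : cts g <-> forall x, II x -> forall e : R, 0 < e ->
  exists2 d : R, 0 < d & forall y, II y -> `|x - y| < d -> normc (g x - g y) < e.
Proof.
split=> [/subspace_continuousP ch x Ix e e0|ch].
  have e0' : 0 < e%:C :> R[i] by rewrite ltcR.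
  have /cvgrPdist_lt/(_ e%:C e0') := ch x Ix.
  rewrite near_withinE => /nbhs_ballP[d /= d0 dh]; exists d => // y Iy xy.
  by have := dh y xy Iy; rewrite normc_norm ltcR.
apply/subspace_continuousP => x Ix; apply/cvgrPdist_lt => e e0.
have eE : e = (Re e)%:C by rewrite RRe_real// gtr0_real.
have e0' : 0 < Re e by rewrite -(ltcR 0) -eE.
have [d d0 dh] := ch x Ix _ e0'.
rewrite near_withinE; apply/nbhs_ballP; exists d => //= y xy Iy.
by rewrite normc_norm eE ltcR; exact: dh.
Qed.

(** Reduces continuity, and below integration, to real and imaginary parts. *)
Lemma ctsE g : cts g <-> rcts (fun x => Re (g x)) /\ rcts (fun x => Im (g x)).
Proof.
split=> [/ctsP cg|[/rctsP cr /rctsP ci]].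
  split; apply/rctsP => x Ix e e0; have [d d0 dg] := cg x Ix e e0; exists d => //.
    move=> y Iy xy; apply: le_lt_trans (dg y Iy xy).
    by rewrite -ReN -ReD; exact: le_Re_normc.
  move=> y Iy xy; apply: le_lt_trans (dg y Iy xy).
  by rewrite -ImN -ImD; exact: le_Im_normc.
apply/ctsP => x Ix e e0; have e20 : 0 < e / 2 by rewrite divr_gt0.
have [d1 d10 dr] := cr x Ix _ e20; have [d2 d20 di] := ci x Ix _ e20.
exists (Num.min d1 d2); first by rewrite lt_min d10.
move=> y Iy; rewrite lt_min => /andP[/(dr y Iy) h1 /(di y Iy) h2].
rewrite (le_lt_trans (normc_le_ReIm _))// ReD ReN ImD ImN.
by rewrite [ltRHS]splitr ltrD.
Qed.

Lemma rcts_cst (c : R) : rcts (fun=> c).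
Proof. by apply/rctsP => x Ix e e0; exists 1 => // y _ _; rewrite subrr normr0. Qed.

Lemma rcts_id : rcts (fun x => x).
Proof. by apply/rctsP => x Ix e e0; exists e. Qed.

Lemma rctsD h1 h2 : rcts h1 -> rcts h2 -> rcts (fun x => h1 x + h2 x).
Proof. by move=> c1 c2 x; apply: continuousD; [exact: c1|exact: c2]. Qed.

Lemma rctsM h1 h2 : rcts h1 -> rcts h2 -> rcts (fun x => h1 x * h2 x).
Proof. by move=> c1 c2 x; apply: continuousM; [exact: c1|exact: c2]. Qed.

Lemma rctsN h : rcts h -> rcts (fun x => - h x).
Proof. by move=> c1 x; apply: continuousN; exact: c1. Qed.

Lemma rctsB h1 h2 : rcts h1 -> rcts h2 -> rcts (fun x => h1 x - h2 x).
Proof. by move=> c1 c2; exact: (rctsD c1 (rctsN c2)). Qed.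

Lemma rctsX h n : rcts h -> rcts (fun x => h x ^+ n).
Proof.
move=> ch; elim: n => [|n ih]; first exact: rcts_cst.
by under [X in rcts X]funext do rewrite exprS; exact: rctsM.
Qed.

Lemma continuous_rcts h : continuous h -> rcts h.
Proof. exact: continuous_subspaceT. Qed.

Lemma ctsD g1 g2 : cts g1 -> cts g2 -> cts (fun x => g1 x + g2 x).
Proof.
move=> /ctsE[r1 i1] /ctsE[r2 i2]; apply/ctsE; split.
  by under [X in rcts X]funext do rewrite ReD; exact: rctsD.
by under [X in rcts X]funext do rewrite ImD; exact: rctsD.
Qed.

Lemma ctsM g1 g2 : cts g1 -> cts g2 -> cts (fun x => g1 x * g2 x).
Proof.
move=> /ctsE[r1 i1] /ctsE[r2 i2]; apply/ctsE; split.
  by under [X in rcts X]funext do rewrite ReM; apply: rctsB; exact: rctsM.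
by under [X in rcts X]funext do rewrite ImM; apply: rctsD; exact: rctsM.
Qed.

Lemma cts_cst (c : R[i]) : cts (fun=> c).
Proof. by apply/ctsE; split; exact: rcts_cst. Qed.

Lemma ctsZ (c : R[i]) g : cts g -> cts (fun x => c * g x).
Proof. by move=> cg; exact: (ctsM (@cts_cst c) cg). Qed.

Lemma ctsN g : cts g -> cts (fun x => - g x).
Proof.
by move=> cg; under [X in cts X]funext do rewrite -mulN1r; exact: ctsZ.
Qed.

Lemma ctsB g1 g2 : cts g1 -> cts g2 -> cts (fun x => g1 x - g2 x).
Proof. by move=> c1 c2; exact: (ctsD c1 (ctsN c2)). Qed.

Lemma cts_sum n (F : 'I_n -> R -> R[i]) :
  (forall i, cts (F i)) -> cts (fun x => \sum_(i < n) F i x).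
Proof.
elim: n F => [|n ih] F cF.
  by under [X in cts X]funext do rewrite big_ord0; exact: cts_cst.
under [X in cts X]funext do rewrite big_ord_recr /=.
by apply: ctsD; [exact: ih|exact: cF].
Qed.

Lemma rcts_normc g : cts g -> rcts (fun x => normc (g x)).
Proof.
move=> /ctsP cg; apply/rctsP => x Ix e e0; have [d d0 dg] := cg x Ix e e0.
exists d => // y Iy xy; apply: le_lt_trans (dg y Iy xy).
have h1 := normcD (g x - g y) (g y); have h2 := normcD (g y - g x) (g x).
by rewrite !subrK in h1 h2; rewrite ler_norml; rewrite normc_distC in h2; lra.
Qed.

Lemma rcts_norm h : rcts h -> rcts (fun x => `|h x|).
Proof.
by move=> ch x; apply: continuous_comp; [exact: ch|exact: norm_continuous].
Qed.

Lemma rcts_subitv a b h : -1 <= a -> b <= 1 -> rcts h ->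
  {within `[a, b], continuous h}.
Proof.
move=> a1 b1; apply: continuous_subspaceW => t /=.
by rewrite in_itv/= => /andP[at_ tb]; apply/II_itv; lra.
Qed.

Lemma within_rcts h : {within `[-1, 1], continuous h} -> rcts h.
Proof. by []. Qed.

Lemma rcts_bounded h : rcts h -> exists2 M, 0 < M & forall x, II x -> `|h x| <= M.
Proof.
move=> ch; have II_le : -1 <= 1 :> R by lra.
have [||c _ hc] := @EVT_max R (fun x => `|h x|) (-1) 1 => //.
  exact: rcts_norm.
exists (`|h c| + 1); first by rewrite ltr_wpDl.
by move=> x Ix; rewrite (le_trans (hc x _))// lerDl.
Qed.

Lemma cts_bounded g :
  cts g -> exists2 M, 0 < M & forall x, II x -> normc (g x) <= M.
Proof.
move=> /rcts_normc/rcts_bounded[M M0 hM]; exists M => // x /hM.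
by rewrite ger0_norm// normc_ge0.
Qed.

Lemma le_supnorm g x : cts g -> II x -> normc (g x) <= supnorm g.
Proof.
move=> /cts_bounded[M M0 hM] Ix; apply: ub_le_sup; last by exists x.
by exists M => _ [y Iy <-]; exact: hM.
Qed.

Lemma supnorm_le g M : (forall x, II x -> normc (g x) <= M) -> supnorm g <= M.
Proof.
move=> hM; apply: ge_sup; last by move=> _ [y Iy <-]; exact: hM.
by exists (normc (g 0)), 0 => //; apply/II_itv; lra.
Qed.

End Continuity.

Local Opaque cts rcts.

(** * Integration of complex-valued continuous functions *)

Section Integral.
Context {R : realType}.
Implicit Types (h m : R -> R) (g : R -> R[i]) (a b x y : R).

Lemma rcts_integrable a b h : -1 <= a -> b <= 1 -> rcts h ->
  mu.-integrable `[a, b] (EFin \o h).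
Proof.
move=> a1 b1 ch; apply: continuous_compact_integrable.
  exact: segment_compact.
exact: rcts_subitv.
Qed.

Lemma Rintegral_chasles a b c h : -1 <= a -> a <= b -> b <= c -> c <= 1 ->
  rcts h ->
  \int[mu]_(t in `[a, c]) h t =
  \int[mu]_(t in `[a, b]) h t + \int[mu]_(t in `[b, c]) h t.
Proof.
move=> a1 ab bc c1 ch.
have hi := rcts_integrable a1 c1 ch.
have := @Rintegral_itvB R h (BLeft a) (BRight c) b hi.
rewrite !bnd_simp => /(_ ab bc) E.
rewrite -(@Rintegral_itv_obnd_cbnd R b (BRight c)); last first.
  apply: (integrableS _ _ _ hi) => //.
  by apply: subset_itvr; rewrite bnd_simp.
by rewrite -E addrC subrK.
Qed.

Lemma Rintegral_norm_le a b h m : -1 <= a -> b <= 1 -> rcts h -> rcts m ->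
  (forall t, a <= t <= b -> `|h t| <= m t) ->
  `|\int[mu]_(t in `[a, b]) h t| <= \int[mu]_(t in `[a, b]) m t.
Proof.
move=> a1 b1 ch cm hm; apply: (le_trans (le_normr_Rintegral _ _)) => //.
  exact: rcts_integrable.
apply: le_Rintegral => //.
- exact: (rcts_integrable a1 b1 (rcts_norm ch)).
- exact: rcts_integrable.
Qed.

Lemma Rintegral_itv_cst a b (c : R) : a <= b ->
  \int[mu]_(t in `[a, b]) c = c * (b - a).
Proof.
move=> ab; rewrite Rintegral_cst//= /mu lebesgue_measure_itv/= lte_fin.
by move: ab; rewrite le_eqVlt => /predU1P[->|ab]; rewrite ?ltxx ?ab// subrr.
Qed.

(** Integration of the real and imaginary parts separately; estimates lose a
    factor 2, which is harmless since no constant below needs to be sharp. *)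
Definition cint a b g : R[i] :=
  (\int[mu]_(t in `[a, b]) Re (g t)) +i* (\int[mu]_(t in `[a, b]) Im (g t)).

Lemma cts_Re g : cts g -> rcts (fun x => Re (g x)).
Proof. by move=> /ctsE[]. Qed.

Lemma cts_Im g : cts g -> rcts (fun x => Im (g x)).
Proof. by move=> /ctsE[]. Qed.

Lemma eq_cint a b g1 g2 : (forall t, a <= t <= b -> g1 t = g2 t) ->
  cint a b g1 = cint a b g2.
Proof.
by move=> e; congr (_ +i* _); apply: eq_Rintegral => t;
  rewrite inE/= in_itv/= => /e ->.
Qed.

Lemma cintD a b g1 g2 : -1 <= a -> b <= 1 -> cts g1 -> cts g2 ->
  cint a b (fun t => g1 t + g2 t) = cint a b g1 + cint a b g2.
Proof.
move=> a1 b1 c1 c2; apply: complex_eqP; rewrite /cint /=.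
  under eq_Rintegral do rewrite ReD.
  by rewrite RintegralD//; apply: rcts_integrable => //; exact: cts_Re.
under eq_Rintegral do rewrite ImD.
by rewrite RintegralD//; apply: rcts_integrable => //; exact: cts_Im.
Qed.

Lemma cintZ a b (c : R[i]) g : -1 <= a -> b <= 1 -> cts g ->
  cint a b (fun t => c * g t) = c * cint a b g.
Proof.
move=> a1 b1 cg.
have ir := rcts_integrable a1 b1 (cts_Re cg).
have ii := rcts_integrable a1 b1 (cts_Im cg).
have Zi d f : mu.-integrable `[a, b] (EFin \o f) ->
    mu.-integrable `[a, b] (EFin \o (fun x => d * f x)).
  by move=> fi; exact: (integrableZl _ d fi).
apply: complex_eqP; rewrite /cint /= ?ReM ?ImM /=.
  under eq_Rintegral do rewrite ReM.
  by rewrite RintegralB// ?RintegralZl//; exact: Zi.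
under eq_Rintegral do rewrite ImM.
by rewrite RintegralD// ?RintegralZl//; exact: Zi.
Qed.

Lemma cintN a b g : -1 <= a -> b <= 1 -> cts g ->
  cint a b (fun t => - g t) = - cint a b g.
Proof.
move=> a1 b1 cg; rewrite -mulN1r -cintZ//.
by apply: eq_cint => t _; rewrite mulN1r.
Qed.

Lemma cintB a b g1 g2 : -1 <= a -> b <= 1 -> cts g1 -> cts g2 ->
  cint a b (fun t => g1 t - g2 t) = cint a b g1 - cint a b g2.
Proof.
move=> a1 b1 c1 c2.
have cn := ctsN c2.
rewrite (cintD a1 b1 c1 cn).
rewrite (cintN a1 b1 c2).
by [].
Qed.

Lemma cint_sum a b n (F : 'I_n -> R -> R[i]) : -1 <= a -> b <= 1 ->
  (forall i, cts (F i)) ->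
  cint a b (fun t => \sum_(i < n) F i t) = \sum_(i < n) cint a b (F i).
Proof.
move=> a1 b1; elim: n F => [|n ih] F cF.
  rewrite big_ord0 -[RHS](mul0r (cint a b (fun=> 0))).
  rewrite -(cintZ 0 a1 b1 (@cts_cst R 0)).
  by apply: eq_cint => t _; rewrite big_ord0 mulr0.
rewrite big_ord_recr/= -ih; last by move=> i; exact: cF.
have cs := cts_sum (fun i => cF (widen_ord (leqnSn n) i)).
rewrite -(cintD a1 b1 cs (cF ord_max)).
by apply: eq_cint => t _; rewrite big_ord_recr.
Qed.

Lemma cint_chasles x y g : -1 <= x -> x <= y -> y <= 1 -> cts g ->
  cint (-1) y g = cint (-1) x g + cint x y g.
Proof.
move=> x1 xy y1 cg; apply: complex_eqP; rewrite /cint /=;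
  apply: Rintegral_chasles => //; [exact: cts_Re|exact: cts_Im].
Qed.

Lemma cint_point x g : cint x x g = 0.
Proof. by rewrite /cint set_itv1 !Rintegral_set1. Qed.

Lemma cint_norm_le a b g m : -1 <= a -> b <= 1 -> cts g -> rcts m ->
  (forall t, a <= t <= b -> normc (g t) <= m t) ->
  normc (cint a b g) <= 2 * \int[mu]_(t in `[a, b]) m t.
Proof.
move=> a1 b1 cg cm gm; rewrite (le_trans (normc_le_ReIm _))// /cint /=.
rewrite mulrDl mul1r lerD// Rintegral_norm_le//.
- exact: cts_Re.
- by move=> t /gm; apply: le_trans; exact: le_Re_normc.
- exact: cts_Im.
- by move=> t /gm; apply: le_trans; exact: le_Im_normc.
Qed.

Lemma cint_norm_le_cst a b g (M : R) : -1 <= a -> a <= b -> b <= 1 -> cts g ->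
  (forall t, a <= t <= b -> normc (g t) <= M) ->
  normc (cint a b g) <= 2 * M * (b - a).
Proof.
move=> a1 ab b1 cg gM; rewrite -mulrA -Rintegral_itv_cst//.
by apply: cint_norm_le => //; exact: rcts_cst.
Qed.

Lemma cint_lipschitz g (M : R) x y : cts g -> II x -> II y ->
  (forall t, II t -> normc (g t) <= M) ->
  normc (cint (-1) x g - cint (-1) y g) <= 2 * M * `|x - y|.
Proof.
move=> cg /II_itv/andP[x1 x2] /II_itv/andP[y1 y2] gM.
wlog xy : x y x1 x2 y1 y2 / x <= y.
  move=> H; case: (leP x y) => [xy|/ltW yx]; first exact: H.
  by rewrite normc_distC distrC; exact: H.
rewrite (cint_chasles x1 xy y2 cg) opprD addNKr normcN.
rewrite distrC ger0_norm ?subr_ge0//.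
apply: cint_norm_le_cst => // t /andP[xt ty]; apply: gM; apply/II_itv; lra.
Qed.

Lemma cts_cint g : cts g -> cts (fun x => cint (-1) x g).
Proof.
move=> cg; have [M M0 hM] := cts_bounded cg.
apply/ctsP => x Ix e e0; exists (e / (2 * M)).
  by rewrite divr_gt0// mulr_gt0.
move=> y Iy; rewrite ltr_pdivlMr ?mulr_gt0// => xy.
by rewrite (le_lt_trans (cint_lipschitz cg Ix Iy hM))// mulrC.
Qed.

(** At a point x of the interval, shrink to an interval around (or next to) x
    on which g stays within e/4 of g x: the integral of g vanishes there, so g
    x is bounded by e. Working on a one-sided interval covers the end points.
    *)
Lemma cint_eq0 g : cts g -> (forall x, II x -> cint (-1) x g = 0) ->
  forall x, II x -> g x = 0.
Proof.
move=> cg g0 x Ix; apply: normc_eq0; apply/ler_addgt0Pr => e e0.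
have e40 : 0 < e / 4 by rewrite divr_gt0.
have /ctsP/(_ x Ix _ e40)[d d0 hd] := cg.
have [a [b [a1 ab b1 xab]]] : exists a b, [/\ -1 <= a, a < b, b <= 1 &
    forall t, a <= t <= b -> `|x - t| < d].
  move/II_itv : Ix => /andP[x1 x2].
  case: (ltP x 1) => x1'.
    exists x, (Num.min 1 (x + d / 2)); split=> //.
    - by rewrite lt_min x1' ltrDl divr_gt0.
    - by rewrite ge_min lexx.
    move=> t /andP[xt]; rewrite le_min => /andP[_ td].
    by rewrite distrC ger0_norm ?subr_ge0//; lra.
  exists (Num.max (-1) (x - d / 2)), x; split=> //.
  - by rewrite le_max lexx.
  - by rewrite gt_max; apply/andP; split; lra.
  move=> t /andP[]; rewrite ge_max => /andP[_ td] xt.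
  by rewrite ger0_norm ?subr_ge0//; lra.
have Iab t : a <= t <= b -> II t.
  by move=> /andP[? ?]; apply/II_itv; lra.
have gab0 : cint a b g = 0.
  have := cint_chasles a1 (ltW ab) b1 cg.
  by rewrite !g0 ?add0r//; apply: Iab; rewrite lexx ltW.
have cc : cts (fun=> g x) by exact: cts_cst.
have ab' := ltW ab.
have E : cint a b (fun=> g x) = g x * (b - a)%:C.
  rewrite /cint !Rintegral_itv_cst//.
  by apply: complex_eqP; rewrite ?ReM ?ImM /= ?mulr0 ?subr0 ?add0r.
have := cintB a1 b1 cc cg; rewrite E gab0 subr0 => {}E.
have : normc (g x * (b - a)%:C) <= 2 * (e / 4) * (b - a).
  rewrite -E; apply: (cint_norm_le_cst a1 ab' b1 (ctsB cc cg)) => t tab.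
  by rewrite ltW// hd//; [exact: Iab|exact: xab].
rewrite ComplexField.Normc.normcM normcR ger0_norm ?subr_ge0//.
rewrite ler_pM2r ?subr_gt0// => /le_trans; apply; lra.
Qed.

End Integral.

(** * Weighted norms and geometric limits *)

Section Weighted.
Context {R : realType}.
Implicit Types (h m : R -> R) (g : R -> R[i]) (a b x y L M : R).

(** Weight of the sup norm in which integration from -1 contracts by a factor
    2 / L. *)
Definition exp_weight L x : R := expR (L * (x + 1)).

Lemma exp_weight_gt0 L x : 0 < exp_weight L x. Proof. exact: expR_gt0. Qed.

Lemma continuous_exp_weight L : continuous (exp_weight L).
Proof.
move=> x; apply: continuous_comp; last exact: continuous_expR.
by apply: cvgM; [exact: cvg_cst|apply: cvgD; [exact: cvg_id|exact: cvg_cst]].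
Qed.

Lemma exp_weight_ge1 L x : 0 <= L -> II x -> 1 <= exp_weight L x.
Proof.
move=> L0 /II_itv/andP[x1 _]; rewrite /exp_weight -[leLHS]expR0 ler_expR mulr_ge0//; lra.
Qed.

Lemma exp_weight_le L x : 0 <= L -> II x -> exp_weight L x <= expR (L * 2).
Proof.
move=> L0 /II_itv/andP[_ x1]; rewrite /exp_weight ler_expR ler_wpM2l//; lra.
Qed.

Lemma Rintegral_exp_weight L x : 0 < L -> II x ->
  \int[mu]_(t in `[-1, x]) exp_weight L t <= L^-1 * exp_weight L x.
Proof.
move=> L0 /II_itv/andP[]; rewrite le_eqVlt => /predU1P[<- _|x1 x2].
  by rewrite set_itv1 Rintegral_set1 mulr_ge0 ?invr_ge0 ?ltW// exp_weight_gt0.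
have d (t : R) : is_derive t 1 (fun y => L^-1 * exp_weight L y) (exp_weight L t).
  rewrite /exp_weight; apply: is_derive_eq.
  by rewrite /GRing.scale/= addr0 mulr1 mulrCA mulVf ?gt_eqF// mulr1.
have cw := @continuous_exp_weight L.
have -> : \int[mu]_(t in `[-1, x]) exp_weight L t = L^-1 * exp_weight L x - L^-1 * exp_weight L (-1).
  rewrite /Rintegral (@continuous_FTC2 _ _ (fun y => L^-1 * exp_weight L y))//.
  - exact: continuous_subspaceT.
  - split.
    + by move=> t _; exact: ex_derive.
    + apply: cvg_at_right_filter; apply: cvgM; [exact: cvg_cst|exact: cw].
    + apply: cvg_at_left_filter; apply: cvgM; [exact: cvg_cst|exact: cw].
  - by move=> t _; rewrite derive1E; exact: derive_val.
by rewrite lerBlDr lerDl mulr_ge0 ?invr_ge0 ?ltW// exp_weight_gt0.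
Qed.

Lemma cint_weighted L M g x : 0 < L -> 0 <= M -> cts g ->
  (forall t, II t -> normc (g t) <= M * exp_weight L t) -> II x ->
  normc (cint (-1) x g) <= 2 * M / L * exp_weight L x.
Proof.
move=> L0 M0 cg gM Ix; have /II_itv/andP[x1 x2] := Ix.
have cw : rcts (exp_weight L) by apply: continuous_rcts; exact: continuous_exp_weight.
have l1 : -1 <= -1 :> R by [].
have cm : rcts (fun t => M * exp_weight L t) by exact: (rctsM (@rcts_cst R M) cw).
apply: (le_trans (cint_norm_le l1 x2 cg cm _)).
  by move=> t /andP[t1 t2]; apply: gM; apply/II_itv; lra.
rewrite RintegralZl//; last exact: (rcts_integrable l1 x2 cw).
rewrite -!mulrA ler_pM2l// ler_wpM2l//; exact: Rintegral_exp_weight.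
Qed.

Lemma cts_RC h : rcts h -> cts (fun x => (h x)%:C).
Proof. by move=> ch; apply/ctsE; split => //=; exact: rcts_cst. Qed.

End Weighted.

Section Geometric.
Context {R : realType}.

(** The limit is the supremum of the lower bounds r m - 2 C / 2^m, which
    increase with m while the upper bounds r m + 2 C / 2^m decrease. *)
Lemma real_geo_lim (r : nat -> R) (C : R) :
  (forall m, `|r m.+1 - r m| <= C * 2^-1 ^+ m) ->
  exists l, forall m, `|l - r m| <= 2 * C * 2^-1 ^+ m.
Proof.
move=> hr; pose s m := r m - 2 * C * 2^-1 ^+ m.
pose t m := r m + 2 * C * 2^-1 ^+ m.
have C0 m : 0 <= C * 2^-1 ^+ m by apply: le_trans (hr m).
have incs m n : (m <= n)%N -> s m <= s n /\ t n <= t m.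
  elim: n => [|n ih]; first by rewrite leqn0 => /eqP ->.
  rewrite leq_eqVlt => /predU1P[->//|/ih[h1 h2]].
  have := hr n; rewrite ler_norml => /andP[g1 g2].
  split; [apply: (le_trans h1)|apply: (le_trans _ h2)];
    by rewrite /s /t exprS; lra.
have st m n : s m <= t n.
  have [h1 _] := incs m _ (leq_maxl m n); have [_ h2] := incs n _ (leq_maxr m n).
  apply: (le_trans h1); apply: le_trans h2.
  have := C0 (maxn m n); rewrite /s /t; lra.
exists (sup (range s)) => m; rewrite ler_norml; apply/andP; split.
  rewrite lerBrDr addrC; apply: ub_le_sup; last by exists m.
  by exists (t 0%N) => _ [n _ <-].
rewrite lerBlDr [leRHS]addrC; apply: ge_sup; first by exists (s 0%N), 0%N.
by move=> _ [n _ <-]; exact: st.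
Qed.

Lemma le_geo_eq0 (x K : R) : (forall m, x <= K * 2^-1 ^+ m) -> x <= 0.
Proof.
move=> h; have : K * 2^-1 ^+ m @[m --> \oo] --> (0 : R).
  rewrite -[X in _ --> X](mulr0 K); apply: cvgM; first exact: cvg_cst.
  by apply: cvg_expr; rewrite ger0_norm//; lra.
move=> hc; rewrite -(cvg_lim _ hc)//; apply: limr_ge; first by apply/cvg_ex; exists 0.
by apply: nearW => m; exact: h.
Qed.

(** A sequence of continuous functions with geometrically small increments has
    a continuous limit, with an explicit rate that survives in the fixed point
    argument. *)
Lemma cts_geo_lim (phi : nat -> R -> R[i]) (C : R) :
  (forall m, cts (phi m)) ->
  (forall m x, II x -> normc (phi m.+1 x - phi m x) <= C * 2^-1 ^+ m) ->
  exists2 psi, cts psi &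
    forall m x, II x -> normc (psi x - phi m x) <= 4 * C * 2^-1 ^+ m.
Proof.
move=> cphi hphi.
have /choice[psi hpsi] x : exists z : R[i], II x ->
    forall m, normc (z - phi m x) <= 4 * C * 2^-1 ^+ m.
  case: (pselect (II x)) => Ix; last by exists 0.
  have [|lr hlr] := @real_geo_lim (fun m => Re (phi m x)) C.
    by move=> m; rewrite -ReN -ReD (le_trans (le_Re_normc _))// hphi.
  have [|li hli] := @real_geo_lim (fun m => Im (phi m x)) C.
    by move=> m; rewrite -ImN -ImD (le_trans (le_Im_normc _))// hphi.
  exists (lr +i* li) => _ m; rewrite (le_trans (normc_le_ReIm _))//.
  rewrite ReD ReN ImD ImN /=.
  by have := hlr m; have := hli m; lra.
exists psi; last by move=> m x Ix; exact: hpsi.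
apply/ctsP => x Ix e e0.
have [m hm] : exists m, 4 * C * 2^-1 ^+ m < e / 3.
  apply: contrapT => /forallNP hm.
  have : e / 3 <= 0.
    by apply: (@le_geo_eq0 (e / 3) (4 * C)) => m; rewrite leNgt; apply/negP.
  by rewrite leNgt divr_gt0.
have /ctsP/(_ x Ix (e / 3))[|d d0 hd] := cphi m; first by rewrite divr_gt0.
exists d => // y Iy /(hd y Iy) xy.
have -> : psi x - psi y =
    (psi x - phi m x) + ((phi m x - phi m y) - (psi y - phi m y)) by ring.
have h1 := hpsi x Ix m; have h2 := hpsi y Iy m.
have h3 := normcD (psi x - phi m x) ((phi m x - phi m y) - (psi y - phi m y)).
have h4 := normcB (phi m x - phi m y) (psi y - phi m y).
lra.
Qed.

End Geometric.

(** * Classical solutions and the initial value problem *)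

Section ClassicalFamilies.
Context {R : realType}.
Implicit Types (u v : nat -> R -> R[i]) (k : nat).

(** A function of class C^k on the closed interval, presented as the family of
    its derivatives up to order k; derivation is expressed by the integral
    relation, which behaves well at the end points. *)
Definition Ck k u : Prop :=
  (forall l, (l <= k)%N -> cts (u l)) /\
  (forall l, (l < k)%N -> forall x, II x ->
     u l x = u l (-1) + cint (-1) x (u l.+1)).

Lemma CkD k u v : Ck k u -> Ck k v -> Ck k (fun l x => u l x + v l x).
Proof.
move=> [cu pu] [cv pv]; split=> l lk; first exact: (ctsD (cu l lk) (cv l lk)).
move=> x Ix; have /II_itv/andP[_ x1] := Ix.
rewrite (cintD _ x1 (cu _ lk) (cv _ lk))//.
by rewrite (pu l lk x Ix) (pv l lk x Ix); ring.
Qed.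

Lemma CkZ k (c : R[i]) u : Ck k u -> Ck k (fun l x => c * u l x).
Proof.
move=> [cu pu]; split=> l lk; first exact: (ctsZ (cu l lk)).
move=> x Ix; have /II_itv/andP[_ x1] := Ix.
by rewrite (cintZ c _ x1 (cu _ lk))// (pu l lk x Ix) mulrDr.
Qed.

Lemma CkB k u v : Ck k u -> Ck k v -> Ck k (fun l x => u l x - v l x).
Proof.
move=> hu /(CkZ (-1)) hv.
under eq_fun do under eq_fun do rewrite -mulN1r.
exact: CkD.
Qed.

Lemma Ck_sum k n (F : 'I_n -> nat -> R -> R[i]) : (forall i, Ck k (F i)) ->
  Ck k (fun l x => \sum_(i < n) F i l x).
Proof.
move=> hF; split=> l lk.
  by apply: cts_sum => i; have [cF _] := hF i; exact: cF.
move=> x Ix; have /II_itv/andP[_ x1] := Ix.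
rewrite cint_sum//; last by move=> i; have [cF _] := hF i; exact: cF.
by rewrite -big_split; apply: eq_bigr => i _; have [_ pF] := hF i; exact: pF.
Qed.

Lemma Ck_eq0 k u : Ck k u -> (forall x, II x -> u 0%N x = 0) ->
  forall l, (l <= k)%N -> forall x, II x -> u l x = 0.
Proof.
move=> [cu pu] u0; elim=> [//|l ih] lk.
apply: (cint_eq0 (cu _ lk)) => x Ix.
have Im1 : @II R (-1) by apply/II_itv; lra.
have := pu l lk x Ix; rewrite !ih ?(ltnW lk)// add0r => E.
by rewrite -E.
Qed.

(** The terms of order below k of the differential operator; on the interval
    the operator is [lower_order] plus the k-th derivative since its leading
    coefficient is 1. *)
Definition lower_order k (a : nat -> R -> R[i]) u (x : R) : R[i] :=
  \sum_(j < k) a j x * u j x.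

Lemma diffopE k a u x : a k x = 1 -> diffop k a u x = lower_order k a u x + u k x.
Proof. by move=> ak; rewrite /diffop big_ord_recr/= ak mul1r. Qed.

Lemma cts_lower_order k a u : (forall j, (j < k)%N -> cts (a j)) ->
  (forall j, (j < k)%N -> cts (u j)) -> cts (lower_order k a u).
Proof.
move=> ca cu; apply: cts_sum => j.
exact: (ctsM (ca j (ltn_ord j)) (cu j (ltn_ord j))).
Qed.

Lemma coef_bound k (a : nat -> R -> R[i]) : (forall j, (j < k)%N -> cts (a j)) ->
  exists2 A, 0 < A & forall j, (j < k)%N -> forall x, II x -> normc (a j x) <= A.
Proof.
elim: k => [|k ih] ca; first by exists 1.
have [|A A0 hA] := ih; first by move=> j jk; apply: ca; exact: ltnW.
have [B B0 hB] := cts_bounded (ca k (ltnSn k)).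
exists (A + B) => [|j]; first exact: addr_gt0.
rewrite ltnS leq_eqVlt => /predU1P[-> x Ix|jk x Ix].
  by rewrite (le_trans (hB _ _))// lerDr ltW.
by rewrite (le_trans (hA _ _ _ _))// lerDl ltW.
Qed.

Lemma lower_order_le k a u x (A M : R) : 0 <= A -> 
  (forall j, (j < k)%N -> normc (a j x) <= A) ->
  (forall j, (j < k)%N -> normc (u j x) <= M) ->
  normc (lower_order k a u x) <= k%:R * (A * M).
Proof.
move=> A0 hA hM; rewrite (le_trans (normc_sum _))//.
apply: (@le_trans _ _ (\sum_(j < k) A * M)).
  apply: ler_sum => j _; rewrite ComplexField.Normc.normcM.
  by rewrite ler_pM ?normc_ge0 ?hA ?hM.
by rewrite sumr_const card_ord mulr_natl.
Qed.

Lemma lower_orderB k a u v x :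
  lower_order k a u x - lower_order k a v x = lower_order k a (fun l y => u l y - v l y) x.
Proof. by rewrite /lower_order -sumrB; apply: eq_bigr => j _; rewrite mulrBr. Qed.

Lemma lower_orderD k a u v x :
  lower_order k a u x + lower_order k a v x = lower_order k a (fun l y => u l y + v l y) x.
Proof. by rewrite /lower_order -big_split; apply: eq_bigr => j _; rewrite mulrDr. Qed.

Lemma lower_orderZ k a (c : R[i]) u x :
  c * lower_order k a u x = lower_order k a (fun l y => c * u l y) x.
Proof. by rewrite /lower_order mulr_sumr; apply: eq_bigr => j _; rewrite mulrCA. Qed.

(** The i-th iterated primitive of phi based at -1, with the i-th primitive
    taking the value [d i.-1] there; it builds a function from its k-th
    derivative and its initial data. *)
Fixpoint iter_prim (d : nat -> R[i]) (phi : R -> R[i]) (i : nat) : R -> R[i] :=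
  if i is i'.+1 then fun x => d i' + cint (-1) x (iter_prim d phi i') else phi.

Lemma cts_iter_prim d phi i : cts phi -> cts (iter_prim d phi i).
Proof.
move=> cphi; elim: i => [//|i ih] /=.
exact: (ctsD (@cts_cst _ _) (cts_cint ih)).
Qed.

Lemma Ck_iter_prim k d phi : cts phi -> Ck k (fun l => iter_prim d phi (k - l)).
Proof.
move=> cphi; split=> l lk; first exact: cts_iter_prim.
by move=> x Ix; rewrite -[(k - l)%N]prednK ?subn_gt0//= -subnS cint_point addr0.
Qed.

(** Iterated integration never expands the weighted norm of a difference, and
    any primitive of order at least one gains the factor 2 / L. *)
Lemma iter_prim_weighted d phi psi (L M : R) : 2 <= L -> 0 <= M ->
  cts phi -> cts psi ->
  (forall x, II x -> normc (phi x - psi x) <= M * exp_weight L x) ->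
  forall i x, II x ->
  normc (iter_prim d phi i x - iter_prim d psi i x) <= M * exp_weight L x /\
  normc (iter_prim d phi i.+1 x - iter_prim d psi i.+1 x) <= 2 * M / L * exp_weight L x.
Proof.
move=> L2 M0 cphi cpsi hM; have L0 : 0 < L by lra.
have step i : (forall x, II x ->
      normc (iter_prim d phi i x - iter_prim d psi i x) <= M * exp_weight L x) ->
    forall x, II x ->
      normc (iter_prim d phi i.+1 x - iter_prim d psi i.+1 x) <= 2 * M / L * exp_weight L x.
  move=> hi x Ix; have /II_itv/andP[_ x1] := Ix.
  rewrite /= opprD addrACA subrr add0r.
  have c1 := @cts_iter_prim d phi i cphi; have c2 := @cts_iter_prim d psi i cpsi.
  rewrite -(cintB _ x1 c1 c2)//.
  exact: (cint_weighted L0 M0 (ctsB c1 c2) hi Ix).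
have le1 x : 2 * M / L * exp_weight L x <= M * exp_weight L x.
  rewrite ler_wpM2r ?(ltW (exp_weight_gt0 _ _))// ler_pdivrMr// mulrC ler_wpM2l//.
suff hi i x : II x -> normc (iter_prim d phi i x - iter_prim d psi i x) <= M * exp_weight L x.
  by move=> i x Ix; split; [exact: hi|apply: step => // y; exact: hi].
elim: i x => [|i ih] x Ix; first exact: hM.
by apply: le_trans (le1 x); apply: step.
Qed.

(** Taking the k-th derivative phi as unknown turns the initial value problem
    into the fixed point equation phi = f - (lower-order terms of the iterated
    primitives of phi). For L large the right-hand side contracts by 1/2 in
    the weighted norm, so Picard iteration converges geometrically. *)
Lemma ivp_exists k (a : nat -> R -> R[i]) (f : R -> R[i]) (c : nat -> R[i]) :
  (forall j, (j < k)%N -> cts (a j)) -> cts f ->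
  exists u, [/\ Ck k u, forall j, (j < k)%N -> u j (-1) = c j &
    forall x, II x -> lower_order k a u x + u k x = f x].
Proof.
move=> ca cf; have [A A0 hA] := coef_bound ca.
pose d i := c (k - i.+1)%N.
pose fam phi l : R -> R[i] := iter_prim d phi (k - l).
(* the k lower-order terms contribute at most k A (2 M / L), to be below M / 2 *)
pose L : R := 2 + 4 * k%:R * A.
have L2 : 2 <= L by rewrite /L lerDl mulr_ge0// ltW.
have L0 : 0 < L by lra.
have cfam phi l : cts phi -> cts (fam phi l) by exact: cts_iter_prim.
have contr phi psi (M : R) : 0 <= M -> cts phi -> cts psi ->
    (forall x, II x -> normc (phi x - psi x) <= M * exp_weight L x) ->
    forall x, II x ->
    normc (lower_order k a (fam phi) x - lower_order k a (fam psi) x) <= M / 2 * exp_weight L x.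
  move=> M0 c1 c2 hM x Ix; rewrite lower_orderB.
  apply: (le_trans (@lower_order_le k a _ x A (2 * M / L * exp_weight L x) _ _ _)).
  - exact: ltW.
  - by move=> j jk; exact: hA.
  - move=> j jk; rewrite /fam -[(k - j)%N]prednK ?subn_gt0//.
    by have [_] := iter_prim_weighted d L2 M0 c1 c2 hM (k - j).-1 Ix.
  rewrite !mulrA ler_wpM2r ?(ltW (exp_weight_gt0 _ _))// ler_pdivrMr//.
  have -> : M / 2 * L = M + k%:R * A * 2 * M by rewrite /L; field.
  by rewrite lerDr.
pose Phi phi x := f x - lower_order k a (fam phi) x.
have cPhi phi : cts phi -> cts (Phi phi).
  by move=> cp; exact: (ctsB cf (cts_lower_order ca (fun j _ => cfam phi j cp))).
(* Picard iteration *)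
pose phi m := iter m Phi (fun=> 0).
have cphi m : cts (phi m).
  by elim: m => [|m ih]; [exact: cts_cst|exact: cPhi].
have [M0 M00 hM0] := cts_bounded (cphi 1%N).
have dphi m x : II x ->
    normc (phi m.+1 x - phi m x) <= M0 * 2^-1 ^+ m * exp_weight L x.
  elim: m x => [|m ih] x Ix.
    rewrite expr0 mulr1 subr0 (le_trans (hM0 x Ix))// ler_peMr ?(ltW M00)//.
    by rewrite exp_weight_ge1// ltW.
  have -> : phi m.+2 x - phi m.+1 x =
      - (lower_order k a (fam (phi m.+1)) x - lower_order k a (fam (phi m)) x).
    have E n : phi n.+1 x = f x - lower_order k a (fam (phi n)) x by [].
    by rewrite !E; ring.
  rewrite normcN exprSr mulrA.
  have h0 : 0 <= M0 * 2^-1 ^+ m by rewrite mulr_ge0 ?exprn_ge0// ltW.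
  exact: (contr _ _ _ h0 (cphi _) (cphi _) ih x Ix).
have hdphi m x : II x ->
    normc (phi m.+1 x - phi m x) <= M0 * expR (L * 2) * 2^-1 ^+ m.
  move=> Ix; rewrite (le_trans (dphi m x Ix))// -!mulrA ler_wpM2l ?(ltW M00)//.
  by rewrite mulrC ler_wpM2r ?exprn_ge0// exp_weight_le// ltW.
have [psi cpsi hpsi] := cts_geo_lim cphi hdphi.
set C := M0 * expR (L * 2) in hpsi hdphi.
have C0 : 0 <= C by rewrite mulr_ge0 ?expR_ge0 ?ltW.
exists (fam psi); split.
- exact: Ck_iter_prim.
- move=> j jk; rewrite /fam -[(k - j)%N]prednK ?subn_gt0//=.
  by rewrite cint_point addr0 /d prednK ?subn_gt0// subKn// ltnW.
move=> x Ix; rewrite {2}/fam subnn /=.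
apply/eqP; rewrite -subr_eq0; apply/eqP; apply: normc_eq0.
apply: (@le_geo_eq0 _ _ (2 * C + 2 * C * expR (L * 2))) => m.
have -> : lower_order k a (fam psi) x + psi x - f x =
    (psi x - phi m.+1 x) + (lower_order k a (fam psi) x - lower_order k a (fam (phi m)) x).
  by rewrite /phi /= -/(phi m) /Phi; ring.
rewrite (le_trans (normcD _ _))// [leRHS]mulrDl lerD//.
  by rewrite (le_trans (hpsi m.+1 x Ix))// exprS; lra.
have h0 : 0 <= 4 * C * 2^-1 ^+ m.
  by apply: mulr_ge0; [apply: mulr_ge0|apply: exprn_ge0].
have hw y : II y -> normc (psi y - phi m y) <= 4 * C * 2^-1 ^+ m * exp_weight L y.
  move=> Iy; apply: (le_trans (hpsi m y Iy)); rewrite ler_peMr//.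
  by rewrite exp_weight_ge1// ltW.
apply: (le_trans (contr _ _ _ h0 cpsi (cphi m) hw x Ix)).
have -> : 2 * C * expR (L * 2) * 2^-1 ^+ m = 4 * C * 2^-1 ^+ m / 2 * expR (L * 2).
  by field.
by apply: ler_wpM2l; [exact: divr_ge0|apply: exp_weight_le => //; exact: ltW].
Qed.

End ClassicalFamilies.

(** * L2 estimates *)

Section L2.
Context {R : realType}.
Implicit Types (g : R -> R[i]) (x y M : R).

Lemma IIE : @II R = `[-1, 1]%classic. Proof. by []. Qed.

Lemma rcts_normc2 g : cts g -> rcts (fun x => normc (g x) ^+ 2).
Proof. by move=> cg; apply: rctsX; exact: rcts_normc. Qed.

Lemma L2norm_ge0 g : 0 <= L2norm g.
Proof. exact: sqrtr_ge0. Qed.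

Lemma L2norm_sqr g : L2norm g ^+ 2 = \int[mu]_(x in II) (normc (g x) ^+ 2).
Proof. by rewrite sqr_sqrtr// Rintegral_ge0// => x _; exact: sqr_ge0. Qed.

Lemma eq_L2norm g1 g2 : (forall x, II x -> g1 x = g2 x) -> L2norm g1 = L2norm g2.
Proof.
move=> e; congr (Num.sqrt _); apply: eq_Rintegral => x.
by rewrite inE => /e ->.
Qed.

Lemma le_Rintegral_II (h1 h2 : R -> R) : rcts h1 -> rcts h2 ->
  (forall x, II x -> h1 x <= h2 x) ->
  \int[mu]_(x in II) h1 x <= \int[mu]_(x in II) h2 x.
Proof.
move=> c1 c2 h12; apply: le_Rintegral => //; first exact: measurable_itv.
  exact: (rcts_integrable (lexx _) (lexx _) c1).
exact: (rcts_integrable (lexx _) (lexx _) c2).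
Qed.

Lemma L2norm_le_sup g M : cts g -> 0 <= M ->
  (forall x, II x -> normc (g x) <= M) -> L2norm g <= 2 * M.
Proof.
move=> cg M0 gM; rewrite -(@ler_pXn2r _ 2)// ?nnegrE ?L2norm_ge0 ?mulr_ge0//.
rewrite L2norm_sqr.
apply: (le_trans (le_Rintegral_II (rcts_normc2 cg) (@rcts_cst R (M ^+ 2)) _)).
  by move=> x Ix; rewrite ler_sqr ?nnegrE ?normc_ge0// gM.
rewrite Rintegral_itv_cst//.
have -> : (2 * M) ^+ 2 = 4 * M ^+ 2 by ring.
by have := sqr_ge0 M; lra.
Qed.

Lemma L2normD g1 g2 : cts g1 -> cts g2 ->
  L2norm (fun x => g1 x + g2 x) <= 2 * (L2norm g1 + L2norm g2).
Proof.
move=> c1 c2; have n1 := L2norm_ge0 g1; have n2 := L2norm_ge0 g2.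
rewrite -(@ler_pXn2r _ 2)// ?nnegrE ?L2norm_ge0 ?mulr_ge0 ?addr_ge0//.
rewrite L2norm_sqr.
have d1 := rcts_normc2 c1; have d2 := rcts_normc2 c2.
have d1' := rctsM (@rcts_cst R 2) d1; have d2' := rctsM (@rcts_cst R 2) d2.
apply: (le_trans (le_Rintegral_II (rcts_normc2 (ctsD c1 c2)) (rctsD d1' d2') _)).
  move=> x _; have h := normcD (g1 x) (g2 x).
  have h0 := normc_ge0 (g1 x + g2 x); have hs := sqr_ge0 (normc (g1 x) - normc (g2 x)).
  have : normc (g1 x + g2 x) ^+ 2 <= (normc (g1 x) + normc (g2 x)) ^+ 2.
    by rewrite ler_sqr ?nnegrE ?addr_ge0 ?normc_ge0.
  by move: hs; rewrite sqrrB sqrrD; lra.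
have i1 := rcts_integrable (lexx (-1)) (lexx 1) d1.
have i2 := rcts_integrable (lexx (-1)) (lexx 1) d2.
have i1' := rcts_integrable (lexx (-1)) (lexx 1) d1'.
have i2' := rcts_integrable (lexx (-1)) (lexx 1) d2'.
have mII : measurable (@II R) by exact: measurable_itv.
rewrite RintegralD//= !RintegralZl// -!L2norm_sqr. have := mulr_ge0 n1 n2; have -> : (2 * (L2norm g1 + L2norm g2)) ^+ 2 = 4 * L2norm g1 ^+ 2 +
  8 * (L2norm g1 * L2norm g2) + 4 * L2norm g2 ^+ 2 by ring.
have := sqr_ge0 (L2norm g1); have := sqr_ge0 (L2norm g2); lra.
Qed.

(** Minimising Q - 2 c I + c^2 d over c, the discriminant form of
    Cauchy-Schwarz. *)
Lemma quadratic_min (Q I c d N : R) : 0 <= Q - 2 * c * I + c ^+ 2 * d ->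
  Q <= N -> c * d = I -> 0 <= d -> I ^+ 2 <= d * N.
Proof.
move=> h QN E d0; rewrite -E in h *; have -> : (c * d) ^+ 2 = d * (c ^+ 2 * d) by ring.
by apply: ler_wpM2l => //; lra.
Qed.

Lemma Rintegral_cauchy x y g : -1 <= x -> x < y -> y <= 1 -> cts g ->
  (\int[mu]_(t in `[x, y]) normc (g t)) ^+ 2 <= (y - x) * L2norm g ^+ 2.
Proof.
move=> x1 xy y1 cg; have c1 := rcts_normc cg; have c2 := rcts_normc2 cg.
have h2 : \int[mu]_(t in `[x, y]) (normc (g t) ^+ 2) <= L2norm g ^+ 2.
  have l1 : -1 <= -1 :> R by []. have l2 : 1 <= 1 :> R by [].
  rewrite L2norm_sqr IIE (@Rintegral_chasles _ (-1) x 1)//; last lra.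
  rewrite (@Rintegral_chasles _ x y 1)//; last lra.
  have p1 : 0 <= \int[mu]_(t in `[-1, x]) (normc (g t) ^+ 2).
    by apply: Rintegral_ge0 => t _; exact: sqr_ge0.
  have p2 : 0 <= \int[mu]_(t in `[y, 1]) (normc (g t) ^+ 2).
    by apply: Rintegral_ge0 => t _; exact: sqr_ge0.
  by rewrite addrCA lerDl addr_ge0.
set I := \int[mu]_(t in `[x, y]) normc (g t).
(* the minimiser of the quadratic form in c *)
pose c := I / (y - x).
have i2 := rcts_integrable x1 y1 c2.
have c3 := rctsM (@rcts_cst R (2 * c)) c1.
have i3 := rcts_integrable x1 y1 c3.
have i4 := rcts_integrable x1 y1 (@rcts_cst R (c ^+ 2)).
have i5 := rcts_integrable x1 y1 (rctsB c2 c3).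
have yx : 0 < y - x by rewrite subr_gt0.
have h : 0 <= \int[mu]_(t in `[x, y]) (normc (g t) ^+ 2) - 2 * c * I + c ^+ 2 * (y - x).
  rewrite /I -RintegralZl//; last exact: (rcts_integrable x1 y1 c1).
  rewrite -(Rintegral_itv_cst _ (ltW xy)) -RintegralB// -RintegralD//.
  apply: Rintegral_ge0 => t _.
  by have := sqr_ge0 (normc (g t) - c); nra.
have cE : c * (y - x) = I by rewrite /c divfK// gt_eqF.
exact: (quadratic_min h h2 cE (ltW yx)).
Qed.

(** A primitive of a square integrable function is Hoelder of exponent 1/2;
    this is the source of the term N^(1/2) in the growth condition on the
    Lebesgue constants. *)
Lemma cint_L2 g x y : cts g -> II x -> II y ->
  normc (cint (-1) x g - cint (-1) y g) <= 2 * (Num.sqrt `|x - y| * L2norm g).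
Proof.
move=> cg /II_itv/andP[x1 x2] /II_itv/andP[y1 y2].
wlog xy : x y x1 x2 y1 y2 / x < y.
  move=> H; case: (ltgtP x y) => [xy|yx|->]; first exact: H.
    by rewrite normc_distC distrC; exact: H.
  by rewrite subrr ComplexField.Normc.normc0 mulr_ge0// mulr_ge0 ?sqrtr_ge0.
rewrite (cint_chasles x1 (ltW xy) y2 cg) opprD addNKr normcN.
rewrite distrC gtr0_norm ?subr_gt0//.
apply: (le_trans (cint_norm_le x1 y2 cg (rcts_normc cg) (fun _ _ => lexx _))).
rewrite ler_pM2l// -(@ler_pXn2r _ 2)// ?nnegrE.
- by rewrite exprMn sqr_sqrtr ?subr_ge0 ?(ltW xy)//; exact: Rintegral_cauchy.
- by apply: Rintegral_ge0 => t _; exact: normc_ge0.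
- by rewrite mulr_ge0 ?sqrtr_ge0.
Qed.

Lemma cint_le_L2 g x : cts g -> II x -> normc (cint (-1) x g) <= 4 * L2norm g.
Proof.
move=> cg Ix; have Im1 : @II R (-1) by apply/II_itv; lra.
have := cint_L2 cg Ix Im1; rewrite cint_point subr0 => /le_trans; apply.
have -> : 4 = 2 * 2 :> R by ring.
rewrite -!mulrA ler_pM2l// ler_wpM2r ?L2norm_ge0//.
rewrite -(@ler_pXn2r _ 2)// ?nnegrE ?sqrtr_ge0// sqr_sqrtr//.
by move/II_itv : Ix => /andP[h1 h2]; rewrite ger0_norm; lra.
Qed.

Lemma supnorm_ge0 g : cts g -> 0 <= supnorm g.
Proof.
move=> cg; have I0 : @II R 0 by apply/II_itv; lra.
exact: le_trans (normc_ge0 _) (le_supnorm cg I0).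
Qed.

(** Let M be the weighted sup norm of the derivative of order k-1. Integrating
    the equation once bounds M by the L2 norm of the right-hand side plus M /
    2, where the last term is the contribution of the lower-order terms for L
    large. *)
Lemma zero_data_bound k (a : nat -> R -> R[i]) :
  (forall j, (j < k)%N -> cts (a j)) ->
  exists2 C, 0 < C & forall z, Ck k z ->
    (forall j, (j < k)%N -> z j (-1) = 0) ->
    forall j, (j < k)%N -> forall x, II x ->
      normc (z j x) <= C * L2norm (fun x => lower_order k a z x + z k x).
Proof.
case: k => [_|k ca]; first by exists 1.
have [A A0 hA] := coef_bound ca.
pose L : R := 2 + 4 * k.+1%:R * A.
have L2 : 2 <= L by rewrite /L lerDl mulr_ge0// ltW.
have L0 : 0 < L by lra.
have L0' := ltW L0.
exists (8 * expR (L * 2)) => [|z [cz pz] z0]; first by rewrite mulr_gt0// expR_gt0.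
have cl := cts_lower_order ca (fun j jk => cz j (ltnW jk)).
have cg := ctsD cl (cz _ (leqnn _)).
set g := fun x => _; set G := L2norm g.
have zE j x : (j < k.+1)%N -> II x -> z j x = cint (-1) x (z j.+1).
  by move=> jk Ix; rewrite (pz j jk x Ix) z0// add0r.
pose w x : R[i] := z k x * (expR (- (L * (x + 1))))%:C.
have cexp : rcts (fun x : R => expR (- (L * (x + 1)))).
  apply: continuous_rcts => x; apply: continuous_comp; last exact: continuous_expR.
  apply: continuousN.
  by apply: cvgM; [exact: cvg_cst|apply: cvgD; [exact: cvg_id|exact: cvg_cst]].
have cw : cts w by exact: (ctsM (cz _ (leqnSn k)) (cts_RC cexp)).
pose M := supnorm w; have M0 : 0 <= M by exact: supnorm_ge0.
have wE x : normc (w x) = normc (z k x) * (exp_weight L x)^-1.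
  by rewrite ComplexField.Normc.normcM normcR ger0_norm ?expR_ge0// expRN.
have hk x : II x -> normc (z k x) <= M * exp_weight L x.
  move=> Ix; rewrite -ler_pdivrMr ?exp_weight_gt0// -wE; exact: le_supnorm.
have hj i x : (i <= k)%N -> II x -> normc (z (k - i)%N x) <= M * exp_weight L x.
  elim: i x => [|i ih] x ik Ix; first by rewrite subn0; exact: hk.
  have kiS : (k - i.+1).+1 = (k - i)%N by rewrite subnS prednK ?subn_gt0.
  rewrite zE//; last by rewrite ltnS leq_subr.
  have ci : cts (z (k - i)%N) by apply: cz; rewrite (leq_trans (leq_subr _ _)).
  rewrite kiS.
  apply: (le_trans (cint_weighted L0 M0 ci (fun t => ih t (ltnW ik)) Ix)).
  rewrite ler_wpM2r ?(ltW (exp_weight_gt0 _ _))// ler_pdivrMr// mulrC ler_wpM2l//.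
have hj' j x : (j < k.+1)%N -> II x -> normc (z j x) <= M * exp_weight L x.
  by move=> jk Ix; rewrite -(subKn (_ : j <= k)%N)// hj// leq_subr.
have hlot x : II x -> normc (lower_order k.+1 a z x) <= k.+1%:R * (A * M) * exp_weight L x.
  move=> Ix; rewrite -!mulrA mulrA.
  rewrite -mulrA; apply: lower_order_le; first exact: ltW.
  - by move=> j jk; exact: hA.
  - by move=> j jk; exact: hj'.
(* the equation integrated once, in the weighted norm *)
have hw : M <= 4 * G + M / 2.
  apply: supnorm_le => x Ix; have /II_itv/andP[_ x1] := Ix.
  rewrite wE ler_pdivrMr ?exp_weight_gt0// zE//.
  have -> : cint (-1) x (z k.+1) = cint (-1) x g - cint (-1) x (lower_order k.+1 a z).
    rewrite -(cintB _ x1 cg cl)//; apply: eq_cint => t _; rewrite /g; ring.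
  rewrite (le_trans (normcB _ _))// mulrDl lerD//.
    rewrite (le_trans (cint_le_L2 cg Ix))// ler_peMr ?mulr_ge0 ?L2norm_ge0//.
    exact: exp_weight_ge1.
  have h0 : 0 <= k.+1%:R * (A * M) by rewrite mulr_ge0// mulr_ge0// ltW.
  rewrite (le_trans (cint_weighted L0 h0 cl hlot Ix))//.
  rewrite ler_wpM2r ?(ltW (exp_weight_gt0 _ _))// ler_pdivrMr//.
  have -> : M / 2 * L = M + 2 * (k.+1%:R * (A * M)) by rewrite /L; field.
  by rewrite lerDr.
move=> j jk x Ix; rewrite (le_trans (hj' j x jk Ix))//.
have hM : M <= 8 * G by lra.
rewrite (le_trans (ler_wpM2r (ltW (exp_weight_gt0 L x)) hM))// mulrAC.
rewrite ler_wpM2r ?L2norm_ge0// ler_pM2l//.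
exact: exp_weight_le.
Qed.

End L2.

(** * The boundary value problem *)

Lemma unitmx_inj (F : fieldType) n (A : 'M[F]_n) :
  (forall c : 'cV[F]_n, A *m c = 0 -> c = 0) -> A \in unitmx.
Proof.
move=> inj; rewrite -unitmx_tr -row_free_unit -kermx_eq0.
apply/eqP/row_matrixP => i; apply: (can_inj (@trmxK _ _ _)).
rewrite row0 trmx0; apply: inj; apply: (can_inj (@trmxK _ _ _)).
by rewrite trmx_mul trmxK trmx0 -row_mul mulmx_ker row0.
Qed.

Section BVP.
Context {R : realType} (k : nat) (S T : 'M[R[i]]_k).
Implicit Types (u v : nat -> R -> R[i]).

Definition boundary_form u : 'cV[R[i]]_k :=
  S *m (\col_(j < k) u j (-1)) + T *m (\col_(j < k) u j 1).

Lemma boundary_formD u v : boundary_form (fun l x => u l x + v l x) = boundary_form u + boundary_form v.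
Proof.
rewrite /boundary_form [in RHS]addrACA -!mulmxDr.
by congr (_ + _); congr (_ *m _); apply/colP => j; rewrite !mxE.
Qed.

Lemma boundary_formZ (c : R[i]) u : boundary_form (fun l x => c * u l x) = c *: boundary_form u.
Proof.
rewrite /boundary_form scalerDr !scalemxAr.
by congr (_ + _); congr (_ *m _); apply/colP => j; rewrite !mxE.
Qed.

Lemma boundary_formB u v : boundary_form (fun l x => u l x - v l x) = boundary_form u - boundary_form v.
Proof.
rewrite -[- boundary_form v]scaleN1r -boundary_formZ -boundary_formD; congr boundary_form.
by apply/funext => l; apply/funext => x; rewrite mulN1r.
Qed.

Lemma boundary_form_sum n (F : 'I_n -> nat -> R -> R[i]) :
  boundary_form (fun l x => \sum_(i < n) F i l x) = \sum_(i < n) boundary_form (F i).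
Proof.
rewrite /boundary_form big_split /= -!mulmx_sumr; congr (_ + _); congr (_ *m _);
  apply/colP => j; rewrite mxE summxE; apply: eq_bigr => i _; by rewrite mxE.
Qed.

Lemma mulmx_bound m n (A : 'M[R[i]]_(m, n)) : exists2 K, 0 <= K &
  forall (w : 'cV[R[i]]_n) (M : R), 0 <= M -> (forall j, normc (w j 0) <= M) ->
  forall i, normc ((A *m w) i 0) <= K * M.
Proof.
exists (\sum_i \sum_j normc (A i j)) => [|w M M0 wM i].
  by apply: sumr_ge0 => i _; apply: sumr_ge0 => j _; exact: normc_ge0.
rewrite mxE (le_trans (normc_sum _))// mulr_suml (bigD1 i)//= ler_wpDr//.
  apply: sumr_ge0 => i' _; rewrite mulr_ge0//.
  by apply: sumr_ge0 => j _; exact: normc_ge0.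
rewrite mulr_suml; apply: ler_sum => j _.
by rewrite ComplexField.Normc.normcM ler_wpM2l// normc_ge0.
Qed.

Variable a : nat -> R -> R[i].
Hypothesis ca : forall j, (j < k)%N -> cts (a j).
Hypothesis uniq : forall u, Ck k u ->
  (forall x, II x -> lower_order k a u x + u k x = 0) -> boundary_form u = 0 ->
  forall x, II x -> u 0%N x = 0.

Lemma fundamental_system : exists Y : 'I_k -> nat -> R -> R[i],
  [/\ forall i, Ck k (Y i),
      forall i j : 'I_k, Y i j (-1) = (i == j)%:R &
      forall i x, II x -> lower_order k a (Y i) x + Y i k x = 0].
Proof.
have /choice[Y hY] (i : 'I_k) := ivp_exists (fun j => (i == j :> nat)%:R) ca
  (@cts_cst R 0).
exists Y; split=> [i|i j|i]; have [h1 h2 h3] := hY i => //.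
by rewrite h2.
Qed.

Lemma comb_Ck (Y : 'I_k -> nat -> R -> R[i]) (c : 'cV[R[i]]_k) :
  (forall i, Ck k (Y i)) -> Ck k (fun l x => \sum_(i < k) c i 0 * Y i l x).
Proof. by move=> hY; apply: Ck_sum => i; apply: CkZ. Qed.

Lemma comb_lower_order (Y : 'I_k -> nat -> R -> R[i]) (c : 'cV[R[i]]_k) x :
  (forall i, lower_order k a (Y i) x + Y i k x = 0) ->
  lower_order k a (fun l y => \sum_(i < k) c i 0 * Y i l y) x +
  \sum_(i < k) c i 0 * Y i k x = 0.
Proof.
move=> hY; rewrite /lower_order.
under eq_bigr do rewrite mulr_sumr.
rewrite exchange_big/= -big_split/= big1// => i _.
have := congr1 (fun z => c i 0 * z) (hY i); rewrite mulr0 mulrDr => E; rewrite -[RHS]E.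
by congr (_ + _); rewrite lower_orderZ; apply: eq_bigr => j _.
Qed.

(** Boundary values of a fundamental system, one column for each solution. *)
Definition boundary_mx (Y : 'I_k -> nat -> R -> R[i]) : 'M[R[i]]_k :=
  \matrix_(r, i) boundary_form (Y i) r 0.

Lemma boundary_mxE Y (c : 'cV[R[i]]_k) :
  boundary_mx Y *m c = boundary_form (fun l x => \sum_(i < k) c i 0 * Y i l x).
Proof.
rewrite boundary_form_sum; apply/colP => r; rewrite mxE summxE.
by apply: eq_bigr => i _; rewrite boundary_formZ !mxE mulrC.
Qed.

(** A vector in the kernel gives a combination of the fundamental system
    solving the homogeneous boundary value problem, hence zero; its
    coefficients are its initial data. *)
Lemma boundary_mx_unit Y : (forall i, Ck k (Y i)) ->
  (forall i j : 'I_k, Y i j (-1) = (i == j)%:R) ->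
  (forall i x, II x -> lower_order k a (Y i) x + Y i k x = 0) ->
  boundary_mx Y \in unitmx.
Proof.
move=> cY Y0 LY.
apply: unitmx_inj => c; rewrite boundary_mxE => Bc.
have h0 := uniq (comb_Ck c cY) (fun x Ix => comb_lower_order c (fun i => LY i x Ix)) Bc.
have hl := Ck_eq0 (comb_Ck c cY) h0.
apply/colP => j; rewrite mxE.
have Im1 : @II R (-1) by apply/II_itv; lra.
have := hl j (ltnW (ltn_ord j)) _ Im1.
rewrite (bigD1 j)//= Y0 eqxx mulr1 big1 ?addr0// => i ij.
by rewrite Y0 (negbTE ij) mulr0.
Qed.

(** Correct a solution with zero initial data by the combination of the
    fundamental system that restores the boundary conditions. *)
Lemma bvp_exists (f : R -> R[i]) (b : 'cV[R[i]]_k) : cts f ->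
  exists u, [/\ Ck k u, forall x, II x -> lower_order k a u x + u k x = f x & boundary_form u = b].
Proof.
move=> cf; have [Y [cY Y0 LY]] := fundamental_system.
have uY := boundary_mx_unit cY Y0 LY.
have [w [cw _ Lw]] := ivp_exists (fun=> 0) ca cf.
pose c := invmx (boundary_mx Y) *m (b - boundary_form w).
exists (fun l x => w l x + \sum_(i < k) c i 0 * Y i l x); split.
- exact: (CkD cw (comb_Ck c cY)).
- move=> x Ix; rewrite -lower_orderD addrACA Lw// comb_lower_order ?addr0// => i; exact: LY.
- by rewrite boundary_formD -boundary_mxE mulKVmx// addrC subrK.
Qed.

(** Removing from v the homogeneous solution with the same initial data leaves
    z, which [zero_data_bound] controls. As v has homogeneous boundary
    conditions, the coefficients removed are determined by the boundary values
    of z through the inverse of [boundary_mx], and so are controlled too. *)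
Lemma bvp_stable : exists2 C, 0 < C & forall v, Ck k v -> boundary_form v = 0 ->
  forall j, (j < k)%N -> forall x, II x ->
    normc (v j x) <= C * L2norm (fun x => lower_order k a v x + v k x).
Proof.
have [Y [cY Y0 LY]] := fundamental_system.
have uY := boundary_mx_unit cY Y0 LY.
have [C C0 hC] := zero_data_bound ca.
have [K K0 hK] := mulmx_bound (- invmx (boundary_mx Y)).
have [KS KS0 hKS] := mulmx_bound S.
have [KT KT0 hKT] := mulmx_bound T.
have [B B0 hB] : exists2 B, 0 < B & forall (i : 'I_k) j, (j < k)%N ->
    forall x, II x -> normc (Y i j x) <= B.
  have /choice[B hB] (i : 'I_k) : exists B, forall j, (j < k)%N ->
      forall x, II x -> normc (Y i j x) <= B.
    have [B _ hB] := coef_bound (fun j (jk : (j < k)%N) => (cY i).1 j (ltnW jk)).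
    by exists B.
  exists (1 + \sum_i `|B i|).
    by rewrite ltr_wpDr// sumr_ge0.
  move=> i j jk x Ix; rewrite (le_trans (hB i j jk x Ix))// (bigD1 i)//= addrCA.
  by rewrite (le_trans (ler_norm _))// lerDl addr_ge0// sumr_ge0.
exists (C + k%:R * (K * ((KS + KT) * C) * B)) => [|v cv bv j jk x Ix].
  have C0' := ltW C0; have B0' := ltW B0.
  by apply: ltr_wpDr => //; do ?[exact: addr_ge0|apply: mulr_ge0 => //].
set G := L2norm _.
have G0 : 0 <= G by exact: L2norm_ge0.
pose c : 'cV[R[i]]_k := \col_i v i (-1).
pose z l x := v l x - \sum_(i < k) c i 0 * Y i l x.
have cz : Ck k z by exact: (CkB cv (comb_Ck c cY)).
have Im1 : @II R (-1) by apply/II_itv; lra.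
have I1 : @II R 1 by apply/II_itv; lra.
have z0 i : (i < k)%N -> z i (-1) = 0.
  move=> ik; pose i' := Ordinal ik; rewrite /z (bigD1 i')//= (Y0 i' i') eqxx mulr1.
  rewrite big1 ?addr0 ?mxE ?subrr// => i2 i2i.
  by rewrite (Y0 i2 i') (negbTE i2i) mulr0.
have zG : L2norm (fun x => lower_order k a z x + z k x) = G.
  apply: eq_L2norm => y Iy; rewrite /z -lower_orderB.
  have := @comb_lower_order Y c y (fun i => LY i y Iy).
  move=> E; rewrite addrACA -opprD E oppr0 addr0//.
have hz := hC z cz z0; rewrite zG in hz.
have CG0 : 0 <= C * G by rewrite mulr_ge0// ltW.
have bz r : normc (boundary_form z r 0) <= (KS + KT) * C * G.
  rewrite /boundary_form mxE (le_trans (normcD _ _))// mulrDl mulrDl -!mulrA lerD//.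
    by apply: hKS => // i; rewrite mxE; exact: hz.
  by apply: hKT => // i; rewrite mxE; exact: hz.
have cE : c = - invmx (boundary_mx Y) *m boundary_form z.
  by rewrite boundary_formB bv -boundary_mxE sub0r mulNmx mulmxN opprK mulKmx.
have hc i : normc (c i 0) <= K * ((KS + KT) * C * G).
  by rewrite cE; apply: hK => //; rewrite mulr_ge0// mulr_ge0 ?addr_ge0// ltW.
have -> : v j x = z j x + \sum_(i < k) c i 0 * Y i j x by rewrite subrK.
rewrite (le_trans (normcD _ _))// mulrDl lerD//; first exact: hz.
rewrite (le_trans (normc_sum _))//.
apply: (@le_trans _ _ (\sum_(i < k) K * ((KS + KT) * C * G) * B)).
  apply: ler_sum => i _; rewrite ComplexField.Normc.normcM.
  by rewrite ler_pM ?normc_ge0// hB.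
rewrite sumr_const card_ord -[leLHS]mulr_natl.
have -> : k%:R * (K * ((KS + KT) * C) * B) * G =
  k%:R * (K * ((KS + KT) * C * G) * B) by ring.
by [].
Qed.

End BVP.

(** * The Fejer-Korovkin kernel *)

Section Jackson.
Context {R : realType}.
Implicit Types (t x y : R) (n : nat).

Lemma sin_le_id y : 0 <= y -> sin y <= y.
Proof.
rewrite le_eqVlt => /predU1P[<-|y0]; first by rewrite sin0.
have [|c _] := @MVT R sin cos 0 y y0 (fun z _ => is_derive_sin z).
  by apply: continuous_subspaceT; exact: continuous_sin.
rewrite sin0 !subr0 => ->.
by apply: ler_piMl; [exact: ltW|exact: cos_le1].
Qed.

Lemma cos_ge_sqr y : 0 <= y <= pi -> 2 * (1 - cos y) <= y ^+ 2.
Proof.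
move=> /andP[y0 ypi]; have yE : y = (y / 2) *+ 2 by rewrite -mulr_natr divfK.
rewrite {1}yE cos_mulr2n cos2sin2.
have s0 : 0 <= sin (y / 2) by apply: sin_ge0_pi; lra.
have s1 : sin (y / 2) <= y / 2 by apply: sin_le_id; lra.
have s2 : sin (y / 2) ^+ 2 <= (y / 2) ^+ 2 by rewrite ler_sqr ?nnegrE//; lra.
have -> : y ^+ 2 = 4 * (y / 2) ^+ 2 by field.
lra.
Qed.

(** Chebyshev polynomials of the first kind. *)
Fixpoint cheb n : {poly R} :=
  if n is n1.+1 then
    if n1 is n2.+1 then 2 *: ('X * cheb n1) - cheb n2 else 'X
  else 1.

Lemma size_cheb n : (size (cheb n) <= n.+1)%N.
Proof.
elim/ltn_ind: n => -[|[|n]] ih; rewrite ?size_poly1 ?size_polyX//.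
rewrite [cheb _]/= (leq_trans (size_polyD _ _))// geq_max size_polyN.
rewrite (leq_trans (size_scale_leq _ _))/=; last first.
  rewrite (leq_trans (size_polyMleq _ _))// size_polyX /=.
  exact: (ih n.+1 (ltnSn _)).
by rewrite (leq_trans (ih n _))//; lia.
Qed.

Lemma horner_cheb n t : (cheb n).[cos t] = cos (n%:R * t).
Proof.
elim/ltn_ind: n => -[|[|n]] ih.
- by rewrite mul0r cos0 hornerC.
- by rewrite mul1r hornerX.
rewrite [cheb _]/= -/(cheb n.+1) hornerD hornerN hornerZ hornerM hornerX.
rewrite !ih; [|lia|lia].
have -> : n.+2%:R * t = n.+1%:R * t + t by rewrite -[n.+2]addn1 natrD; ring.
have -> : n%:R * t = n.+1%:R * t - t by rewrite -[n.+1]addn1 natrD; ring.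
by rewrite cosB cosD; ring.
Qed.

Variable n : nat.
Hypothesis n0 : (0 < n)%N.

Let d : R := pi / n.+1%:R.
Let node (m : nat) : R := 2 * m%:R * d.

Let nd : n.+1%:R * d = pi.
Proof. by rewrite /d mulrCA divff ?mulr1// pnatr_eq0. Qed.

Let d0 : 0 < d. Proof. by rewrite divr_gt0 ?pi_gt0// ltr0n. Qed.

(** Multiplied by 2 sin (l d), the sum telescopes to a difference of sines
    whose arguments differ by a multiple of 2 pi. *)
Lemma sum_cos_node (l : nat) (phi : R) : (0 < l <= n)%N ->
  \sum_(m < n.+1) cos (phi - l%:R * node m) = 0.
Proof.
move=> /andP[l0 ln].
have sl : sin (l%:R * d) != 0.
  apply/lt0r_neq0/sin_gt0_pi; rewrite mulr_gt0 ?ltr0n//= -nd ltr_pM2r//.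
  by rewrite ltr_nat.
apply: (mulfI (mulf_neq0 (_ : 2 != 0) sl)); first by rewrite pnatr_eq0.
rewrite mulr0 mulr_sumr.
pose s (m : nat) := sin (phi + l%:R * d - l%:R * node m).
have -> : \sum_(m < n.+1) 2 * sin (l%:R * d) * cos (phi - l%:R * node m) =
    \sum_(m < n.+1) - (s m.+1 - s m).
  apply: eq_bigr => m _; rewrite /s.
  have -> : phi + l%:R * d - l%:R * node m = (phi - l%:R * node m) + l%:R * d by ring.
  have -> : phi + l%:R * d - l%:R * node m.+1 = (phi - l%:R * node m) - l%:R * d.
    by rewrite /node -[m.+1]addn1 natrD; ring.
  by move: (phi - _) => y; rewrite sinB sinD; ring.
rewrite sumrN -(big_mkord xpredT (fun m => s m.+1 - s m)) telescope_sumr//.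
rewrite /s; have -> : l%:R * node n.+1 = (pi *+ 2) *+ l.
  by rewrite /node -[2 * _ * d]mulrA nd -[RHS]mulr_natl -[pi *+ 2]mulr_natl.
have -> : l%:R * node 0 = 0 by rewrite /node; ring.
have := periodicn (@sinD2pi R) l (phi + l%:R * d - (pi *+ 2) *+ l).
by rewrite subrK subr0 => ->; rewrite subrr oppr0.
Qed.

Let e (i j : nat) : R := i%:R - j%:R.

Lemma cos_node_orthogonal (i j : nat) t : (i <= n)%N -> (j <= n)%N ->
  \sum_(m < n.+1) cos (e i j * (t - node m)) = n.+1%:R * (i == j)%:R.
Proof.
have aux (l : nat) : (0 < l <= n)%N ->
    \sum_(m < n.+1) cos (l%:R * (t - node m)) = 0.
  by move=> hl; under eq_bigr do rewrite mulrBr; exact: sum_cos_node.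
move=> iN jN; rewrite /e; case: (ltngtP i j) => ij /=.
- rewrite mulr0 -[RHS](aux (j - i)%N); last by lia.
  by apply: eq_bigr => m _; rewrite natrB ?(ltnW ij)// -cosN -mulNr opprB.
- rewrite mulr0 -[RHS](aux (i - j)%N); last by lia.
  by apply: eq_bigr => m _; rewrite natrB ?(ltnW ij).
- rewrite ij subrr mulr1; under eq_bigr do rewrite mul0r cos0.
  by rewrite sumr_const card_ord.
Qed.

Let s (j : nat) : R := sin (j%:R * d).
Let c (j : nat) : R := s j.+1.

(** The Fejer-Korovkin kernel, squared modulus of the trigonometric polynomial
    with coefficients sin ((j + 1) d), where d = pi / (n + 1). *)
Definition fk_ker t : R := \sum_(i < n) \sum_(j < n) c i * c j * cos (e i j * t).

Definition fk_sqnorm : R := \sum_(j < n) c j ^+ 2.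

Lemma fk_ker_ge0 t : 0 <= fk_ker t.
Proof.
suff -> : fk_ker t = (\sum_(j < n) c j * cos (j%:R * t)) ^+ 2 +
    (\sum_(j < n) c j * sin (j%:R * t)) ^+ 2 by rewrite addr_ge0 ?sqr_ge0.
rewrite !expr2 !mulr_suml -big_split; apply: eq_bigr => i _ /=.
rewrite !mulr_sumr -big_split; apply: eq_bigr => j _ /=.
by rewrite /e mulrBl cosB; ring.
Qed.

Lemma fk_kerN t : fk_ker (- t) = fk_ker t.
Proof.
by apply: eq_bigr => i _; apply: eq_bigr => j _; rewrite mulrN cosN.
Qed.

Lemma fk_sqnorm_gt0 : 0 < fk_sqnorm.
Proof.
rewrite /fk_sqnorm (bigD1 (Ordinal n0))//= ltr_pwDl//; last first.
  by apply: sumr_ge0 => i _; exact: sqr_ge0.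
rewrite exprn_gt0// /c /s; apply: sin_gt0_pi; rewrite mul1r d0 -nd /=.
by rewrite ltr_pMl// ltr1n.
Qed.

Lemma fk_ker_sum t : \sum_(m < n.+1) fk_ker (t - node m) = n.+1%:R * fk_sqnorm.
Proof.
rewrite exchange_big/= /fk_sqnorm mulr_sumr; apply: eq_bigr => i _.
rewrite exchange_big/= (bigD1 i)//= -mulr_sumr cos_node_orthogonal ?(ltnW (ltn_ord i))//.
rewrite eqxx mulr1 big1 ?addr0; first by ring.
move=> j ji; rewrite -mulr_sumr cos_node_orthogonal ?(ltnW (ltn_ord _))//.
by rewrite eq_sym (negbTE (ji : (j != i :> nat))) !mulr0.
Qed.

(** The coefficients of the kernel form an eigenvector of the path graph on n
    vertices, with eigenvalue 2 cos d: sin satisfies s (j + 2) + s j = 2 cos d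
    * s (j + 1) and vanishes at both ends. *)
Lemma tridiag : \sum_(j < n) c j * c j.+1 = cos d * fk_sqnorm.
Proof.
have s0 : s 0 = 0 by rewrite /s mul0r sin0.
have sn : s n.+1 = 0 by rewrite /s nd sinpi.
have shift : \sum_(j < n) c j * c j.+1 = \sum_(j < n) s j * s j.+1.
  have : \sum_(j < n.+1) s j * s j.+1 = \sum_(j < n.+1) s j * s j.+1 by [].
  by rewrite [LHS]big_ord_recl [RHS]big_ord_recr/= s0 sn mul0r mulr0 add0r addr0.
have dbl : \sum_(j < n) c j * c j.+1 + \sum_(j < n) s j * s j.+1 =
    2 * (cos d * fk_sqnorm).
  rewrite -big_split /fk_sqnorm !mulr_sumr; apply: eq_bigr => j _ /=.
  rewrite /c /s.
  have -> : j.+2%:R * d = j.+1%:R * d + d by rewrite -[j.+2]addn1 natrD; ring.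
  have -> : j%:R * d = j.+1%:R * d - d by rewrite -[j.+1]addn1 natrD; ring.
  by rewrite sinB sinD; ring.
by move: dbl; rewrite -shift; lra.
Qed.

(** Multiplication by a cosine shifts the frequencies by one, so orthogonality
    keeps the two off-diagonals, each equal to the sum in [tridiag]. *)
Lemma fk_ker_cos_sum t :
  \sum_(m < n.+1) fk_ker (t - node m) * cos (t - node m) =
  n.+1%:R * (cos d * fk_sqnorm).
Proof.
have E m : fk_ker (t - node m) * cos (t - node m) =
    \sum_(i < n) \sum_(j < n) c i * c j / 2 *
      (cos (e i.+1 j * (t - node m)) + cos (e i j.+1 * (t - node m))).
  rewrite mulr_suml; apply: eq_bigr => i _; rewrite mulr_suml.
  apply: eq_bigr => j _; move: (t - node m) => y.
  have -> : e i.+1 j * y = e i j * y + y by rewrite /e -[i.+1]addn1 natrD; ring.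
  have -> : e i j.+1 * y = e i j * y - y by rewrite /e -[j.+1]addn1 natrD; ring.
  by rewrite cosB cosD; field.
under eq_bigr do rewrite E.
rewrite exchange_big/=.
under eq_bigr => i _ do rewrite exchange_big/=.
have E2 (i j : 'I_n) : \sum_(m < n.+1) c i * c j / 2 *
      (cos (e i.+1 j * (t - node m)) + cos (e i j.+1 * (t - node m))) =
    n.+1%:R / 2 * (c i * c j * (i.+1 == j)%:R) +
    n.+1%:R / 2 * (c i * c j * (i == j.+1 :> nat)%:R).
  rewrite -mulr_sumr big_split/= !cos_node_orthogonal ?(ltn_ord i) ?(ltn_ord j)
    ?(ltnW (ltn_ord i)) ?(ltnW (ltn_ord j))//.
  by field.
under eq_bigr => i _ do under eq_bigr => j _ do rewrite E2.
under eq_bigr => i _ do rewrite big_split/= -!mulr_sumr.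
rewrite big_split/= -!mulr_sumr [X in _ + _ * X]exchange_big/=.
have cn : c n = 0 by rewrite /c /s nd sinpi.
have row (i : 'I_n) : \sum_(j < n) c i * c j * (i.+1 == j)%:R = c i * c i.+1.
  case: (ltnP i.+1 n) => iN.
    rewrite (bigD1 (Ordinal iN))//= eqxx mulr1 big1 ?addr0// => j ji.
    rewrite (_ : (i.+1 == j) = false) ?mulr0//; apply/negbTE.
    by apply: contra ji => /eqP ij; apply/eqP/val_inj.
  have -> : i.+1 = n by apply/eqP; rewrite eqn_leq iN ltn_ord.
  rewrite cn mulr0 big1// => j _.
  by rewrite (_ : (n == j) = false) ?mulr0//; have := ltn_ord j; lia.
under eq_bigr do rewrite row.
under [X in _ + _ * X]eq_bigr => j _.
  under eq_bigr => i _ do rewrite [c i * c j]mulrC eq_sym.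
  rewrite row.
  over.
by rewrite tridiag; field.
Qed.

(** Averaging over the kernel centred at an angle and at its opposite makes
    the weights even in the angle, hence polynomials in x = cos t. Their
    second moment about x is at most 2 (1 - cos d), because (cos a - cos b)^2
    <= 2 (1 - cos (a - b)), and d = O(1/n). *)
Lemma positive_kernel : exists (x_ : 'I_n.+1 -> R) (q : 'I_n.+1 -> {poly R}),
  [/\ forall m, II (x_ m), forall m, (size (q m) <= n)%N &
   forall x, II x -> [/\ forall m, 0 <= (q m).[x], \sum_m (q m).[x] = 1 &
     \sum_m (q m).[x] * (x - x_ m) ^+ 2 <= 16 / n%:R ^+ 2]].
Proof.
have Q0 := fk_sqnorm_gt0.
pose nQ : R := n.+1%:R * fk_sqnorm.
have nQ0 : 0 < nQ by rewrite mulr_gt0// ltr0n.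
(* frequencies are differences i - j; the distance i - j + (j - i) on naturals
   indexes the Chebyshev polynomial *)
pose q (m : 'I_n.+1) : {poly R} := nQ^-1 *: \sum_(i < n) \sum_(j < n)
  (c i * c j * cos (e i j * node m)) *: cheb ((i - j) + (j - i)).
have qE m t : (q m).[cos t] = nQ^-1 * ((fk_ker (t - node m) + fk_ker (- t - node m)) / 2).
  rewrite hornerZ -(fk_kerN (- t - _)) opprB opprK; congr (_ * _).
  rewrite -big_split /= mulr_suml horner_sum; apply: eq_bigr => i _.
  rewrite -big_split /= mulr_suml horner_sum; apply: eq_bigr => j _.
  rewrite hornerZ horner_cheb.
  have -> : cos ((i - j + (j - i))%:R * t) = cos (e i j * t).
    rewrite /e; case: (leqP i j) => ij.
      rewrite (_ : (i - j + (j - i) = j - i)%N); last by lia.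
      by rewrite natrB// -cosN -mulNr opprB.
    rewrite (_ : (i - j + (j - i) = i - j)%N); last by lia.
    by rewrite natrB// ltnW.
  by rewrite mulrBr mulrDr cosB cosD; field.
exists (fun m => cos (node m)), q; split.
- by move=> m; apply/II_itv; rewrite cos_geN1 cos_le1.
- move=> m; rewrite (leq_trans (size_scale_leq _ _))//.
  apply: (leq_trans (size_sum _ _ _)); apply/bigmax_leqP => i _.
  apply: (leq_trans (size_sum _ _ _)); apply/bigmax_leqP => j _.
  rewrite (leq_trans (size_scale_leq _ _))// (leq_trans (size_cheb _))//.
  by have := ltn_ord i; have := ltn_ord j; lia.
move=> x Ix; have xE : x = cos (acos x) by rewrite acosK// inE; exact/II_itv.
rewrite xE; set t := acos x; split.
- move=> m; rewrite qE mulr_ge0 ?invr_ge0 ?(ltW nQ0)//.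
  by rewrite divr_ge0// addr_ge0// fk_ker_ge0.
- under eq_bigr do rewrite qE.
  rewrite -mulr_sumr -mulr_suml big_split/= !fk_ker_sum -/nQ.
  by field; exact: lt0r_neq0.
have bnd (a b : R) : (cos a - cos b) ^+ 2 <= 2 * (1 - cos (a - b)).
  have ha := cos2Dsin2 a; have hb := cos2Dsin2 b; have hs := sqr_ge0 (sin a - sin b).
  rewrite cosB.
  have -> : (cos a - cos b) ^+ 2 = cos a ^+ 2 - 2 * (cos a * cos b) + cos b ^+ 2.
    by ring.
  have E : (sin a - sin b) ^+ 2 = sin a ^+ 2 - 2 * (sin a * sin b) + sin b ^+ 2.
    by ring.
  by rewrite E in hs; lra.
have kc (y : R) : \sum_(m < n.+1) fk_ker (y - node m) * (2 * (1 - cos (y - node m))) =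
    2 * (1 - cos d) * nQ.
  transitivity (2 * (\sum_(m < n.+1) fk_ker (y - node m)) -
    2 * \sum_(m < n.+1) fk_ker (y - node m) * cos (y - node m)).
    by rewrite !mulr_sumr -sumrB; apply: eq_bigr => m _; ring.
  by rewrite fk_ker_sum fk_ker_cos_sum /nQ; ring.
apply: (@le_trans _ _ (2 * (1 - cos d))).
  apply: (@le_trans _ _ (\sum_(m < n.+1) nQ^-1 *
      ((fk_ker (t - node m) * (2 * (1 - cos (t - node m))) +
        fk_ker (- t - node m) * (2 * (1 - cos (- t - node m)))) / 2))).
    apply: ler_sum => m _; rewrite qE -mulrA ler_wpM2l ?invr_ge0 ?(ltW nQ0)//.
    rewrite mulrAC ler_wpM2r// mulrDl; apply: lerD.
      by apply: ler_wpM2l; [exact: fk_ker_ge0|exact: bnd].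
    by apply: ler_wpM2l; [exact: fk_ker_ge0|rewrite -(cosN t); exact: bnd].
  rewrite -mulr_sumr -mulr_suml big_split/= !kc.
  by rewrite le_eqVlt; apply/orP; left; apply/eqP; field; exact: lt0r_neq0.
have npos : 0 < n%:R :> R by rewrite ltr0n.
have dpi : 0 <= d <= pi.
  rewrite (ltW d0)/= -nd ler_peMl ?(ltW d0)// ler1n//.
rewrite (le_trans (cos_ge_sqr dpi))//.
have -> : 16 / n%:R ^+ 2 = (4 / n%:R) ^+ 2 :> R by field; exact: lt0r_neq0.
rewrite ler_sqr ?nnegrE ?divr_ge0 ?(ltW d0)//.
rewrite /d ler_pM ?pi_ge0 ?invr_ge0//; first by have := @pihalf_lt2 R; lra.
by rewrite lef_pV2 ?posrE ?ltr0n// ler_nat.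
exact: pi_ge0.
Qed.

End Jackson.

(** * Polynomials and Jackson's theorem *)

Section Polynomials.
Context {R : realType}.
Implicit Types (q : {poly R[i]}) (x : R).

Lemma polyfun0 q x : polyfun q 0 x = q.[x%:C].
Proof. by rewrite /polyfun derivn0. Qed.

Lemma cts_horner q : cts (fun x => q.[x%:C]).
Proof.
elim/poly_ind: q => [|q c ih].
  by under [X in cts X]funext do rewrite horner0; exact: cts_cst.
under [X in cts X]funext do rewrite hornerMXaddC.
exact: (ctsD (ctsM ih (cts_RC (@rcts_id R))) (@cts_cst R c)).
Qed.

Lemma cts_polyfun q l : cts (polyfun q l).
Proof. exact: cts_horner. Qed.

Lemma horner_real (p : {poly R}) x :
  (map_poly (real_complex R) p).[x%:C] = (p.[x])%:C.
Proof. exact: horner_map. Qed.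

Lemma real_poly_ftc (p : {poly R}) x : II x ->
  p.[x] = p.[-1] + \int[mu]_(t in `[-1, x]) p^`().[t].
Proof.
move=> /II_itv/andP[]; rewrite le_eqVlt => /predU1P[<- _|x1 x2].
  by rewrite set_itv1 Rintegral_set1 addr0.
rewrite /Rintegral (@continuous_FTC2 _ _ (horner p))//.
- by rewrite -EFinB /= [RHS]addrC subrK.
- by apply: continuous_subspaceT => t; exact: continuous_horner.
- split; first by move=> t _; exact: derivable_horner.
    by apply: cvg_at_right_filter; exact: continuous_horner.
  by apply: cvg_at_left_filter; exact: continuous_horner.
- by move=> t _; rewrite -derivE.
Qed.

(** By linearity it suffices to treat monomials, which are real polynomials.
    *)
Lemma poly_ftc q x : II x ->
  q.[x%:C] = q.[(-1)%:C] + cint (-1) x (fun t => q^`().[t%:C]).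
Proof.
move=> Ix; have /II_itv/andP[_ x1] := Ix.
have mono i : ('X^i : {poly R[i]}).[x%:C] = ('X^i).[(-1)%:C] +
    cint (-1) x (fun t => ('X^i)^`().[t%:C]).
  have E : 'X^i = map_poly (real_complex R) 'X^i by rewrite map_polyXn.
  have -> : cint (-1) x (fun t => ('X^i)^`().[t%:C]) =
      (\int[mu]_(t in `[-1, x]) ('X^i)^`().[t])%:C.
    rewrite (@eq_cint _ _ _ _ (fun t => (('X^i)^`().[t])%:C)); last first.
      by move=> t _; rewrite E deriv_map horner_real.
    rewrite /cint /=; congr (_ +i* _).
    by rewrite Rintegral_itv_cst ?mul0r//; move/II_itv : Ix => /andP[].
  by rewrite E !horner_real -rmorphD -real_poly_ftc.
rewrite -[q]coefK poly_def.
rewrite !horner_sum.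
have dE t : (\sum_(i < size q) q`_i *: 'X^i)^`().[t%:C] =
    \sum_(i < size q) q`_i * ('X^i)^`().[t%:C].
  by rewrite linear_sum horner_sum; apply: eq_bigr => i _; rewrite linearZ hornerZ.
rewrite (eq_cint (fun t _ => dE t)) cint_sum//; last first.
  by move=> i; apply: ctsZ; exact: cts_horner.
rewrite -big_split; apply: eq_bigr => i _ /=.
by rewrite !hornerZ mono mulrDr cintZ//; exact: cts_horner.
Qed.

Lemma Ck_polyfun k q : Ck k (polyfun q).
Proof.
split=> l _; first exact: cts_polyfun.
by move=> x Ix; rewrite /polyfun (poly_ftc (q^`(l)) Ix).
Qed.

(** With z = n y, bounds z^b by 1 for z <= 1 and by z^2 otherwise; it turns a
    second moment of order n^-2 into a moment of order b of size n^-b. *)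
Lemma powR_le_quad (b y : R) n : (0 < n)%N -> 0 <= b <= 1 -> 0 <= y ->
  y `^ b <= (n%:R `^ b)^-1 * (1 + n%:R ^+ 2 * y ^+ 2).
Proof.
move=> n0 /andP[b0 b1] y0; have np : 0 < n%:R :> R by rewrite ltr0n.
rewrite -ler_pdivrMl ?invr_gt0 ?powR_gt0// invrK -powRM ?(ltW np)//.
rewrite -exprMn; set z := n%:R * y.
have z0 : 0 <= z by rewrite mulr_ge0// ltW.
case: (leP z 1) => z1.
  apply: (@le_trans _ _ 1); last by rewrite lerDl sqr_ge0.
  have e1 : 1 `^ b = 1 :> R by rewrite powR1.
  by rewrite -[leRHS]e1 ge0_ler_powR// nnegrE.
apply: (@le_trans _ _ (z ^+ 2)); last by rewrite lerDr.
rewrite -powR_mulrn//; apply: ler_powR; [exact: ltW|lra].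
Qed.

(** Jackson's theorem for Hoelder functions: average the values of g at the
    nodes of [positive_kernel] against its weights, and sum the moduli of
    continuity. *)
Lemma jackson (g : R -> R[i]) (H b : R) n : (0 < n)%N -> 0 <= b <= 1 -> 0 <= H ->
  (forall x y, II x -> II y -> normc (g x - g y) <= H * `|x - y| `^ b) ->
  exists2 q : {poly R[i]}, (size q <= n)%N &
    forall x, II x -> normc (g x - polyfun q 0 x) <= 17 * H * (n%:R `^ b)^-1.
Proof.
move=> n0 hb H0 hg; have [x_ [q [xI sq hq]]] := @positive_kernel R n n0.
exists (\sum_m g (x_ m) *: map_poly (real_complex R) (q m)).
  apply: (leq_trans (size_sum _ _ _)); apply/bigmax_leqP => m _.
  by rewrite (leq_trans (size_scale_leq _ _))// size_map_poly.
move=> x Ix; have [q0 q1 q2] := hq x Ix.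
rewrite polyfun0 horner_sum.
under eq_bigr do rewrite hornerZ horner_real.
have -> : g x = \sum_m g x * ((q m).[x])%:C.
  by rewrite -mulr_sumr -rmorph_sum q1 mulr1.
rewrite -sumrB (le_trans (normc_sum _))//.
have np : 0 < n%:R :> R by rewrite ltr0n.
apply: (@le_trans _ _ (\sum_m H * (n%:R `^ b)^-1 *
    ((q m).[x] + n%:R ^+ 2 * ((q m).[x] * (x - x_ m) ^+ 2)))).
  apply: ler_sum => m _; rewrite -mulrBl ComplexField.Normc.normcM normcR.
  rewrite (ger0_norm (q0 m)).
  have -> : H * (n%:R `^ b)^-1 *
      ((q m).[x] + n%:R ^+ 2 * ((q m).[x] * (x - x_ m) ^+ 2)) =
    H * ((n%:R `^ b)^-1 * (1 + n%:R ^+ 2 * `|x - x_ m| ^+ 2)) * (q m).[x].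
    by rewrite real_normK ?num_real//; ring.
  rewrite ler_wpM2r// (le_trans (hg x _ Ix (xI m)))// ler_wpM2l//.
  exact: powR_le_quad.
rewrite -mulr_sumr big_split/= q1 -mulr_sumr [17 * H]mulrC -!mulrA.
rewrite ler_wpM2l// mulrC ler_wpM2r ?invr_ge0 ?powR_ge0//.
have : n%:R ^+ 2 * (\sum_m (q m).[x] * (x - x_ m) ^+ 2) <=
    n%:R ^+ 2 * (16 / n%:R ^+ 2) by rewrite ler_wpM2l ?sqr_ge0.
rewrite mulrCA divff ?mulr1; last by rewrite expf_eq0 /= gt_eqF.
lra.
Qed.

End Polynomials.

(** * Interpolation *)

Section Interpolation.
Context {R : realType} (n : nat) (P : 'I_n -> R).
Hypothesis Pinj : injective P.
Hypothesis PI : forall i, II (P i).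
Implicit Types (g : R -> R[i]).

Lemma interpD g h : interp P (fun x => g x + h x) = interp P g + interp P h.
Proof.
by rewrite /interp -big_split; apply: eq_bigr => i _; rewrite scalerDl.
Qed.

Lemma interpZ (c : R[i]) g : interp P (fun x => c * g x) = c *: interp P g.
Proof.
by rewrite /interp scaler_sumr; apply: eq_bigr => i _; rewrite scalerA.
Qed.

Lemma interpB g h : interp P (fun x => g x - h x) = interp P g - interp P h.
Proof.
rewrite -[- interp P h]scaleN1r -interpZ -interpD.
by congr interp; apply/funext => x; rewrite mulN1r.
Qed.

Lemma eq_interp g h : (forall i, g (P i) = h (P i)) -> interp P g = interp P h.
Proof. by move=> e; apply: eq_bigr => i _; rewrite e. Qed.

Lemma interp_poly (q : {poly R[i]}) : (size q <= n)%N ->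
  interp P (polyfun q 0) = q.
Proof.
move=> sq; have [si hi] := interpP (polyfun q 0) Pinj.
apply/eqP; rewrite -subr_eq0; apply/eqP.
apply: (@roots_geq_poly_eq0 _ _ [seq (P i)%:C | i <- enum 'I_n]).
- apply/allP => _ /mapP[i _ ->]; rewrite rootE hornerD hornerN hi polyfun0.
  by rewrite subrr.
- by rewrite map_inj_uniq ?enum_uniq// => i j /complexI/Pinj.
- rewrite size_map size_enum_ord (leq_trans (size_polyD _ _))// geq_max.
  by rewrite size_polyN si sq.
Qed.

(** The supremum defining the Lebesgue constant is over a bounded set, since
    the Lagrange basis polynomials are bounded on the interval; hence it is a
    true upper bound. *)
Lemma lebesgue_const_ub g : cts g -> supnorm g <= 1 ->
  supnorm (polyfun (interp P g) 0) <= lebesgue_const P.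
Proof.
move=> cg g1; apply: ub_le_sup; last by exists g.
pose ell i := \prod_(j < n | j != i)
  (((P i)%:C - (P j)%:C)^-1 *: ('X - ((P j)%:C)%:P)) : {poly R[i]}.
have /choice[B hB] i : exists B, forall x, II x -> normc (ell i).[x%:C] <= B.
  by have [B _ hB] := cts_bounded (@cts_horner R (ell i)); exists B.
exists (\sum_i B i) => _ [h [ch h1] <-].
apply: supnorm_le => x Ix; rewrite polyfun0 /interp horner_sum.
rewrite (le_trans (normc_sum _))//; apply: ler_sum => i _.
rewrite hornerZ ComplexField.Normc.normcM -[leRHS]mul1r.
rewrite ler_pM ?normc_ge0//; last exact: (hB i x Ix).
exact: le_trans (le_supnorm ch (PI i)) h1.
Qed.

Lemma lebesgue_const_ge0 : 0 <= lebesgue_const P.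
Proof.
have c0 := @cts_cst R 0.
apply: le_trans (lebesgue_const_ub c0 _); first exact: (supnorm_ge0 (@cts_polyfun R _ _)).
by apply: supnorm_le => x _; rewrite ComplexField.Normc.normc0.
Qed.

Lemma interp_bound g (M : R) x : cts g -> 0 <= M ->
  (forall y, II y -> normc (g y) <= M) -> II x ->
  normc (polyfun (interp P g) 0 x) <= lebesgue_const P * M.
Proof.
move=> cg; rewrite le_eqVlt => /predU1P[<-|M0] gM Ix.
  rewrite (@eq_interp g (fun=> 0 * 0)); last first.
    by move=> i; rewrite mulr0; exact: normc_eq0 (gM _ (PI i)).
  rewrite (interpZ 0 (fun=> 0)) scale0r mulr0 polyfun0 horner0.
  by rewrite ComplexField.Normc.normc0.
pose h y := (M^-1)%:C * g y.
have ch : cts h by exact: ctsZ.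
have h1 : supnorm h <= 1.
  apply: supnorm_le => y Iy.
  rewrite ComplexField.Normc.normcM normcR gtr0_norm ?invr_gt0//.
  by rewrite mulrC ler_pdivrMr// mul1r gM.
have := le_trans (le_supnorm (@cts_polyfun R (interp P h) 0) Ix)
  (lebesgue_const_ub ch h1).
rewrite interpZ !polyfun0 hornerZ ComplexField.Normc.normcM normcR.
by rewrite gtr0_norm ?invr_gt0// mulrC ler_pdivrMr.
Qed.

(** Lebesgue's lemma: interpolation reproduces the Jackson approximant q, so
    the error is that of g - q, which is amplified at most by one plus the
    Lebesgue constant. *)
Lemma interp_error g (H b : R) x : (0 < n)%N -> 0 <= b <= 1 -> 0 <= H -> cts g ->
  (forall x y, II x -> II y -> normc (g x - g y) <= H * `|x - y| `^ b) -> II x ->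
  normc (g x - polyfun (interp P g) 0 x) <=
  (1 + lebesgue_const P) * (17 * H * (n%:R `^ b)^-1).
Proof.
move=> n0 hb H0 cg hg Ix; have [q sq hq] := jackson n0 hb H0 hg.
have M0 : 0 <= 17 * H * (n%:R `^ b)^-1.
  by apply: mulr_ge0; [exact: mulr_ge0|rewrite invr_ge0 powR_ge0].
have cgq := ctsB cg (@cts_polyfun R q 0).
have h1 := interp_bound cgq M0 hq Ix.
have -> : g x - polyfun (interp P g) 0 x = (g x - polyfun q 0 x) -
    polyfun (interp P (fun y => g y - polyfun q 0 y)) 0 x.
  rewrite interpB interp_poly// !polyfun0 hornerD hornerN; ring.
rewrite (le_trans (normcB _ _))// mulrDl mul1r lerD//.
exact: hq.
Qed.

End Interpolation.

(** * Sobolev families *)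

Section Sobolev.
Context {R : realType}.
Implicit Types (h f F phi : R -> R) (g : R -> R[i]) (u v : nat -> R -> R[i]).

Lemma measurable_II : measurable (@II R).
Proof. exact: measurable_itv. Qed.
Hint Resolve measurable_II : core.

Lemma rcts_itv h : rcts h -> {within `[-1, 1], continuous h}.
Proof. exact: (rcts_subitv (lexx _) (lexx _)). Qed.

Lemma rcts_int h : rcts h -> mu.-integrable II (EFin \o h).
Proof. exact: (rcts_integrable (lexx _) (lexx _)). Qed.

Lemma rcts_measurable h : rcts h -> measurable_fun II h.
Proof. by move=> /rcts_int/integrableP[/measurable_EFinP]. Qed.

Lemma cts_L2 g : cts g -> L2_fun g.
Proof.
move=> cg; split; [exact: rcts_measurable (cts_Re cg)|
  exact: rcts_measurable (cts_Im cg)|].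
have /integrableP[_] := rcts_int (rcts_normc2 cg).
by under eq_integral => x _ do rewrite /= ger0_norm ?sqr_ge0//.
Qed.

Lemma normc2_measurable g : L2_fun g ->
  measurable_fun II (fun x => normc (g x) ^+ 2).
Proof.
move=> [mr mi _]; under [X in measurable_fun _ X]funext do rewrite normc_sqr.
by apply: measurable_funD; exact: measurable_funX.
Qed.

Lemma normc2_integrable g : L2_fun g ->
  mu.-integrable II (EFin \o (fun x => normc (g x) ^+ 2)).
Proof.
move=> L; have [_ _ fin] := L; apply/integrableP; split.
  by apply/measurable_EFinP; exact: normc2_measurable.
by under eq_integral => x _ do rewrite /= ger0_norm ?sqr_ge0//.
Qed.

(** Dominated by a multiple of 1 + |g|^2, as t <= 1 + t^2. *)
Lemma L2_mul_integrable h phi g : L2_fun g -> rcts phi ->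
  measurable_fun II h -> (forall x, II x -> `|h x| <= normc (g x)) ->
  mu.-integrable II (EFin \o (fun x => h x * phi x)).
Proof.
move=> Lg cphi mh hg; have [M M0 hM] := rcts_bounded cphi.
have i1 : mu.-integrable II (EFin \o (fun x => M * (1 + normc (g x) ^+ 2))).
  rewrite (_ : _ \o _ = (fun x : R => M%:E * ((EFin \o (fun=> 1%R)) x +
    (EFin \o (fun x => (normc (g x) ^+ 2)%R)) x))%E); last first.
    by apply/funext => x /=; rewrite -EFinD -EFinM.
  apply: integrableZl => //; apply: integrableD => //.
    exact: rcts_int (@rcts_cst R 1).
  exact: normc2_integrable.
apply: (le_integrable _ _ _ i1) => //.
  by apply/measurable_EFinP/measurable_funM => //; exact: rcts_measurable.
move=> x Ix /=; rewrite lee_fin normrM mulrC.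
rewrite [leRHS]ger0_norm; last first.
  by rewrite mulr_ge0 ?addr_ge0 ?sqr_ge0// ltW.
rewrite ler_pM// ?hM//; apply: (le_trans (hg x Ix)).
have := sqr_ge0 (normc (g x) - 1); have := normc_ge0 (g x); nra.
Qed.

Lemma L2B g1 g2 : L2_fun g1 -> L2_fun g2 -> L2_fun (fun x => g1 x - g2 x).
Proof.
move=> L1 L2; have [r1 i1 _] := L1; have [r2 i2 _] := L2.
have mr : measurable_fun II (fun x => Re (g1 x - g2 x)).
  under [X in measurable_fun _ X]funext do rewrite ReD ReN.
  exact: measurable_funB.
have mi : measurable_fun II (fun x => Im (g1 x - g2 x)).
  under [X in measurable_fun _ X]funext do rewrite ImD ImN.
  exact: measurable_funB.
split=> //.
have mm : measurable_fun II (fun x => normc (g1 x - g2 x) ^+ 2).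
  under [X in measurable_fun _ X]funext do rewrite normc_sqr.
  by apply: measurable_funD; exact: measurable_funX.
have i12 : mu.-integrable II
    (EFin \o (fun x => 2 * (normc (g1 x) ^+ 2 + normc (g2 x) ^+ 2))).
  rewrite (_ : _ \o _ = (fun x : R => 2%:E * ((EFin \o (fun x => (normc (g1 x) ^+ 2)%R)) x +
    (EFin \o (fun x => (normc (g2 x) ^+ 2)%R)) x))%E); last first.
    by apply/funext => x /=; rewrite -EFinD -EFinM.
  by apply: integrableZl => //; apply: integrableD => //; exact: normc2_integrable.
have : mu.-integrable II (EFin \o (fun x => normc (g1 x - g2 x) ^+ 2)).
  apply: (le_integrable _ _ _ i12) => //; first exact/measurable_EFinP.
  move=> x Ix /=; rewrite lee_fin ger0_norm ?sqr_ge0//.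
  rewrite ger0_norm; last by rewrite mulr_ge0// addr_ge0// sqr_ge0.
  have h1 := normcB (g1 x) (g2 x); have h0 := normc_ge0 (g1 x - g2 x).
  have hs := sqr_ge0 (normc (g1 x) - normc (g2 x)).
  have h2 : normc (g1 x - g2 x) ^+ 2 <= (normc (g1 x) + normc (g2 x)) ^+ 2.
    by rewrite ler_sqr ?nnegrE ?addr_ge0 ?normc_ge0.
  by move: hs h2; rewrite sqrrB sqrrD => hs h2; lra.
move=> /integrableP[_].
by under eq_integral => x _ do rewrite /= ger0_norm ?sqr_ge0//.
Qed.

(** Linearity in the form needed to subtract two weak derivatives. *)
Lemma cintegralB g1 g2 phi : L2_fun g1 -> L2_fun g2 -> rcts phi ->
  cintegral (fun x => (g1 x - g2 x) * (phi x)%:C) =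
  cintegral (fun x => g1 x * (phi x)%:C) - cintegral (fun x => g2 x * (phi x)%:C).
Proof.
move=> L1 L2 cphi; have [r1 i1 _] := L1; have [r2 i2 _] := L2.
have le_re x : II x -> `|Re (g1 x)| <= normc (g1 x) by move=> _; exact: le_Re_normc.
have le_re2 x : II x -> `|Re (g2 x)| <= normc (g2 x) by move=> _; exact: le_Re_normc.
have le_im x : II x -> `|Im (g1 x)| <= normc (g1 x) by move=> _; exact: le_Im_normc.
have le_im2 x : II x -> `|Im (g2 x)| <= normc (g2 x) by move=> _; exact: le_Im_normc.
apply: complex_eqP; rewrite /cintegral /=.
  under eq_Rintegral do rewrite ReMr ReD ReN mulrBl.
  under [in RHS]eq_Rintegral do rewrite ReMr.
  under [X in _ = _ - X]eq_Rintegral do rewrite ReMr.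
  by rewrite RintegralB//; [exact: (L2_mul_integrable L1)|exact: (L2_mul_integrable L2)].
under eq_Rintegral do rewrite ImMr ImD ImN mulrBl.
under [in RHS]eq_Rintegral do rewrite ImMr.
under [X in _ = _ - X]eq_Rintegral do rewrite ImMr.
by rewrite RintegralB//; [exact: (L2_mul_integrable L1)|exact: (L2_mul_integrable L2)].
Qed.

Lemma test_fun_rcts phi : test_fun phi -> rcts phi /\ rcts (derive1 phi).
Proof.
move=> [dphi cdphi _]; split; apply: continuous_rcts => // x.
exact/differentiable_continuous/derivable1_diffP.
Qed.

Lemma sobolevB k u v : sobolev k u -> sobolev k v ->
  sobolev k (fun l x => u l x - v l x).
Proof.
move=> [Lu wu cu] [Lv wv cv]; split=> l lk.
- exact: L2B (Lu l lk) (Lv l lk).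
- move=> phi tphi; have [c1 c2] := test_fun_rcts tphi.
  rewrite (cintegralB (Lu l (ltnW lk)) (Lv l (ltnW lk)) c2).
  rewrite (cintegralB (Lu l.+1 lk) (Lv l.+1 lk) c1).
  by rewrite (wu l lk phi tphi) (wv l lk phi tphi) opprB opprK addrC.
- exact: ctsB (cu l lk) (cv l lk).
Qed.

(** Test functions vanish at -1 and 1, so no boundary term appears.
    Integration by parts is applied to the primitive G, defined on the whole
    line, because F is known only on the interval. *)
Lemma by_parts_real F f phi : rcts f ->
  (forall x, II x -> F x = F (-1) + \int[mu]_(t in `[-1, x]) f t) ->
  test_fun phi ->
  \int[mu]_(x in II) (F x * derive1 phi x) = - \int[mu]_(x in II) (f x * phi x).
Proof.
move=> cf FE tphi; have [cphi cdphi] := test_fun_rcts tphi.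
have [dphi _ [a [b [a1 b1 phi0]]]] := tphi.
have N11 : -1 < 1 :> R by lra.
have phi1 : phi 1 = 0 by apply: phi0; lra.
have phiN1 : phi (-1) = 0 by apply: phi0; lra.
pose G x := F (-1) + \int[mu]_(t in `[-1, x]) f t.
have cI := @parameterized_integral_continuous R (-1) 1 f (ltW N11) (rcts_int cf).
have cG := rcts_itv (rctsD (@rcts_cst R (F (-1))) (within_rcts cI)).
rewrite -/G in cG.
have /(continuous_within_itvP _ N11)[cGo cGl cGr] := cG.
have /(continuous_within_itvP _ N11)[cfo _ _] := rcts_itv cf.
have dG x : x \in `]-1, 1[ -> derivable G x 1 /\ derive1 G x = f x.
  move=> xI; have := xI; rewrite in_itv/= => /andP[x1 x2].
  have [d e] := @continuous_FTC1_closed R f (-1) x 1 x2 (rcts_int cf) x1 (cfo x xI).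
  have dc : derivable (cst (F (-1)) : R -> R) x 1 by exact: derivable_cst.
  split; first exact: derivableD.
  by rewrite /G derive1E deriveD// derive_cst add0r -derive1E.
have -> : \int[mu]_(x in II) (F x * derive1 phi x) =
    \int[mu]_(x in `[-1, 1]) (G x * derive1 phi x).
  by apply: eq_Rintegral => x; rewrite inE => Ix; rewrite FE.
have GLR : derivable_oo_LRcontinuous G (-1) 1 by split=> // x /dG[].
have Gf : {in `]-1, 1[, derive1 G =1 f} by move=> x /dG[].
have phiLR : derivable_oo_LRcontinuous phi (-1) 1.
  have /(continuous_within_itvP _ N11)[_ h1 h2] := rcts_itv cphi.
  by split=> // x _.
have phi' : {in `]-1, 1[, derive1 phi =1 derive1 phi} by [].
have := Rintegration_by_parts N11 (rcts_itv cf) GLR Gf (rcts_itv cdphi) phiLR phi'.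
by rewrite phi1 phiN1 !mulr0 subrr sub0r.
Qed.

Lemma Ck_sobolev k u : Ck k u -> sobolev k u.
Proof.
move=> [cu pu]; split=> l lk.
- exact: cts_L2 (cu l lk).
- move=> phi tphi.
  apply: complex_eqP; rewrite /cintegral /=.
    under eq_Rintegral do rewrite ReMr.
    under [in RHS]eq_Rintegral do rewrite ReMr.
    apply: (by_parts_real (cts_Re (cu _ lk))) => // x Ix.
    by rewrite (pu l lk x Ix) ReD.
  under eq_Rintegral do rewrite ImMr.
  under [in RHS]eq_Rintegral do rewrite ImMr.
  apply: (by_parts_real (cts_Im (cu _ lk))) => // x Ix.
  by rewrite (pu l lk x Ix) ImD.
- exact: cu (ltnW lk).
Qed.

Lemma hoelder_cts (alpha : R) g : 0 < alpha -> hoelder_fun alpha g -> cts g.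
Proof.
move=> a0 [K hK]; apply/ctsP => x Ix e e0.
pose M := `|K| + 1; have M0 : 0 < M by rewrite ltr_wpDl.
exists ((e / M) `^ alpha^-1).
  by rewrite powR_gt0// divr_gt0.
move=> y Iy xy; rewrite (le_lt_trans (hK x y Ix Iy))//.
apply: (@le_lt_trans _ _ (M * `|x - y| `^ alpha)).
  rewrite ler_wpM2r ?powR_ge0// (le_trans (ler_norm _))// lerDl//.
rewrite mulrC -ltr_pdivlMr//.
have -> : e / M = ((e / M) `^ alpha^-1) `^ alpha.
  by rewrite -powRrM mulVf ?gt_eqF// powRr1// ltW// divr_gt0.
by apply: gt0_ltr_powR; rewrite ?nnegrE ?powR_ge0.
Qed.

End Sobolev.

(** * Hoelder regularity and stability *)

Section Regularity.
Context {R : realType}.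
Implicit Types (u v : nat -> R -> R[i]) (x y : R).

Lemma powR_lower (d b c : R) : 0 <= d <= 2 -> 0 < b -> b <= c -> c <= 1 ->
  d `^ c <= 2 * d `^ b.
Proof.
move=> /andP[]; rewrite le_eqVlt => /predU1P[<- _|d0 d2] b0 bc c1.
  by rewrite powR0 ?mulr_ge0 ?powR_ge0//; apply: lt0r_neq0; lra.
have -> : c = (c - b) + b by rewrite subrK.
rewrite powRD; last by apply/implyP => _; rewrite gt_eqF.
rewrite ler_wpM2r ?powR_ge0//.
apply: (@le_trans _ _ (2 `^ (c - b))).
  by rewrite ge0_ler_powR ?nnegrE ?subr_ge0// ltW.
by rewrite -[leRHS](@powRr1 R 2)// ler_powR//; lra.
Qed.

Lemma II_dist x y : II x -> II y -> 0 <= `|x - y| <= 2.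
Proof.
by move=> /II_itv/andP[? ?] /II_itv/andP[? ?]; rewrite normr_ge0 ler_norml; lra.
Qed.

Variables (k : nat) (a : nat -> R -> R[i]) (alpha b : R).
Hypothesis b0 : 0 < b.
Hypothesis balpha : b <= alpha.
Hypothesis alpha1 : alpha <= 1.
Hypothesis b2 : b <= 2^-1.
Hypothesis ha : forall j, (j < k)%N -> hoelder_fun alpha (a j).

Lemma coef_cts j : (j < k)%N -> cts (a j).
Proof. by move=> jk; exact: (hoelder_cts (lt_le_trans b0 balpha) (ha jk)). Qed.

Lemma hoelder_lower (g : R -> R[i]) : hoelder_fun alpha g ->
  exists2 H, 0 <= H & forall x y, II x -> II y ->
    normc (g x - g y) <= H * `|x - y| `^ b.
Proof.
move=> [K hK]; exists (2 * `|K|) => [|x y Ix Iy]; first exact: mulr_ge0.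
rewrite (le_trans (hK x y Ix Iy))//.
apply: (@le_trans _ _ (`|K| * `|x - y| `^ alpha)).
  by rewrite ler_wpM2r ?powR_ge0// ler_norm.
by rewrite [2 * _]mulrC -mulrA ler_wpM2l// powR_lower// II_dist.
Qed.

Lemma coef_hoelder : exists2 H, 0 <= H & forall j, (j < k)%N ->
  forall x y, II x -> II y -> normc (a j x - a j y) <= H * `|x - y| `^ b.
Proof.
have /choice[H hH] (j : 'I_k) : exists H, 0 <= H /\ forall x y, II x -> II y ->
    normc (a j x - a j y) <= H * `|x - y| `^ b.
  by have [H H0 hH] := hoelder_lower (ha (ltn_ord j)); exists H.
exists (\sum_j H j) => [|j jk x y Ix Iy].
  by apply: sumr_ge0 => j _; have [] := hH j.
have [_ h] := hH (Ordinal jk); rewrite (le_trans (h x y Ix Iy))//.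
rewrite ler_wpM2r ?powR_ge0// (bigD1 (Ordinal jk))//= lerDl.
by apply: sumr_ge0 => i _; have [] := hH i.
Qed.

(** Derivatives of order below k - 1 are Lipschitz; the one of order k - 1 is
    only Hoelder of exponent 1/2, its derivative being controlled in L2. *)
Lemma Ck_hoelder v (D : R) : Ck k v ->
  (forall j, (j < k)%N -> forall x, II x -> normc (v j x) <= D) ->
  L2norm (v k) <= D ->
  forall j, (j < k)%N -> forall x y, II x -> II y ->
    normc (v j x - v j y) <= 4 * D * `|x - y| `^ b.
Proof.
move=> [cv pv] vD vkD j jk x y Ix Iy.
have D0 : 0 <= D by exact: le_trans (L2norm_ge0 _) vkD.
rewrite (pv j jk x Ix) (pv j jk y Iy) opprD addrACA subrr add0r.
have cj := cv _ jk.
have {}jk := jk; move: (jk); rewrite leq_eqVlt => /predU1P[jE|jk'].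
  rewrite (le_trans (cint_L2 cj Ix Iy))// jE -powR12_sqrt//.
  have -> : 4 * D * `|x - y| `^ b = 2 * (2 * `|x - y| `^ b * D) by ring.
  by rewrite ler_wpM2l// ler_pM ?powR_ge0 ?L2norm_ge0// powR_lower ?II_dist//; have := b0; lra.
rewrite (le_trans (cint_lipschitz cj Ix Iy (vD _ jk')))//.
have -> : 4 * D * `|x - y| `^ b = 2 * D * (2 * `|x - y| `^ b) by ring.
rewrite ler_wpM2l ?mulr_ge0//.
by rewrite -[leLHS]powRr1// powR_lower ?II_dist//; have := b2; lra.
Qed.

(** A Hoelder bound for A v that is linear in the size D of v. *)
Lemma lower_order_hoelder : exists2 H, 0 <= H & forall v (D : R), Ck k v ->
  (forall j, (j < k)%N -> forall x, II x -> normc (v j x) <= D) ->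
  L2norm (v k) <= D ->
  forall x y, II x -> II y ->
    normc (lower_order k a v x - lower_order k a v y) <= H * D * `|x - y| `^ b.
Proof.
have [H H0 hH] := coef_hoelder; have [A A0 hA] := coef_bound coef_cts.
exists (k%:R * (4 * A + H)) => [|v D cv vD vkD x y Ix Iy].
  by apply: mulr_ge0 => //; apply: addr_ge0 => //; apply: mulr_ge0 => //; exact: ltW.
have D0 : 0 <= D by exact: le_trans (L2norm_ge0 _) vkD.
rewrite /lower_order -sumrB (le_trans (normc_sum _))//.
apply: (@le_trans _ _ (\sum_(j < k) (4 * A + H) * D * `|x - y| `^ b)).
  apply: ler_sum => j _; have jk := ltn_ord j.
  have -> : a j x * v j x - a j y * v j y =
      a j x * (v j x - v j y) + (a j x - a j y) * v j y by ring.
  have -> : (4 * A + H) * D * `|x - y| `^ b =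
      A * (4 * D * `|x - y| `^ b) + H * `|x - y| `^ b * D by ring.
  rewrite (le_trans (normcD _ _))// !ComplexField.Normc.normcM; apply: lerD.
    by rewrite ler_pM ?normc_ge0 ?hA//; exact: (Ck_hoelder cv vD vkD).
  by rewrite ler_pM ?normc_ge0//; [exact: hH|exact: vD].
by rewrite sumr_const card_ord -[leLHS]mulr_natl !mulrA.
Qed.

Variables (S T : 'M[R[i]]_k).
Hypothesis uniq : forall u, Ck k u ->
  (forall x, II x -> lower_order k a u x + u k x = 0) -> boundary_form S T u = 0 ->
  forall x, II x -> u 0%N x = 0.

(** Recovers the k-th derivative from the equation once the lower ones are
    bounded. *)
Lemma full_stability : exists2 C, 0 < C & forall v, Ck k v -> boundary_form S T v = 0 ->
  let G := L2norm (fun x => lower_order k a v x + v k x) in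
  (forall j, (j < k)%N -> forall x, II x -> normc (v j x) <= C * G) /\
  L2norm (v k) <= C * G.
Proof.
have [C C0 hC] := bvp_stable coef_cts uniq.
have [A A0 hA] := coef_bound coef_cts.
have kA : 0 <= k%:R * (A * C) by rewrite mulr_ge0// mulr_ge0// ltW.
exists (C + 2 * (1 + 2 * (k%:R * (A * C)))) => [|v cv bv G].
  by rewrite ltr_wpDr// mulr_ge0// addr_ge0// mulr_ge0.
have G0 : 0 <= G by exact: L2norm_ge0.
have hv := hC v cv bv; rewrite -/G in hv.
have CG0 : 0 <= C * G by rewrite mulr_ge0// ltW.
have [cv1 _] := cv.
have cl := cts_lower_order coef_cts (fun j jk => cv1 j (ltnW jk)).
have cg := ctsD cl (cv1 k (leqnn k)).
split=> [j jk x Ix|].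
  rewrite (le_trans (hv j jk x Ix))// ler_wpM2r// lerDl.
  by rewrite mulr_ge0// addr_ge0// mulr_ge0.
have -> : L2norm (v k) = L2norm (fun x => (lower_order k a v x + v k x) + - lower_order k a v x).
  by apply: eq_L2norm => x _; rewrite addrAC subrr add0r.
rewrite (le_trans (L2normD cg (ctsN cl)))// -/G.
have hl : L2norm (fun x => - lower_order k a v x) <= 2 * (k%:R * (A * (C * G))).
  apply: (L2norm_le_sup (ctsN cl)).
    by rewrite mulr_ge0// mulr_ge0// ltW.
  move=> x Ix; rewrite normcN; apply: lower_order_le; first exact: ltW.
    by move=> j jk; exact: hA.
  by move=> j jk; exact: hv.
apply: (@le_trans _ _ (2 * (G + 2 * (k%:R * (A * (C * G)))))).
  by rewrite ler_wpM2l// lerD2l.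
have -> : 2 * (G + 2 * (k%:R * (A * (C * G)))) =
    2 * (1 + 2 * (k%:R * (A * C))) * G by ring.
by rewrite ler_wpM2r// lerDr ltW.
Qed.

Lemma Hnorm_le v (D : R) : Ck k v ->
  (forall j, (j < k)%N -> forall x, II x -> normc (v j x) <= D) ->
  L2norm (v k) <= D -> Hnorm k v <= 2 * k.+1%:R * D.
Proof.
move=> [cv _] vD vkD; have D0 : 0 <= D by exact: le_trans (L2norm_ge0 _) vkD.
rewrite /Hnorm -(@ler_pXn2r _ 2)// ?nnegrE ?sqrtr_ge0 ?mulr_ge0//.
rewrite sqr_sqrtr; last by apply: sumr_ge0 => i _; exact: sqr_ge0.
apply: (@le_trans _ _ (\sum_(l < k.+1) (2 * D) ^+ 2)).
  apply: ler_sum => l _; rewrite ler_sqr ?nnegrE ?L2norm_ge0 ?mulr_ge0//.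
  have := ltn_ord l; rewrite ltnS leq_eqVlt => /predU1P[->|lk].
    by rewrite (le_trans vkD)//; lra.
  exact: (L2norm_le_sup (cv l (ltnW lk)) D0 (vD l lk)).
rewrite sumr_const card_ord -[leLHS]mulr_natl.
have -> : (2 * k.+1%:R * D) ^+ 2 = k.+1%:R * (k.+1%:R * (2 * D) ^+ 2) by ring.
by rewrite ler_wpM2l// ler_peMl ?sqr_ge0// ler1n.
Qed.

End Regularity.

(** * The collocation system *)

Section Collocation.
Context {R : realType} (p : nat -> {poly R}).
Hypothesis sp : forall j, size (p j) = j.+1.

Lemma size_expansion N (c : 'cV[R[i]]_N) : (size (expansion p c) <= N)%N.
Proof.
apply: (leq_trans (size_sum _ _ _)); apply/bigmax_leqP => i _.
by rewrite (leq_trans (size_scale_leq _ _))// size_map_poly sp.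
Qed.

Lemma expansionD N (c1 c2 : 'cV[R[i]]_N) :
  expansion p (c1 + c2) = expansion p c1 + expansion p c2.
Proof.
by rewrite /expansion -big_split; apply: eq_bigr => i _; rewrite mxE scalerDl.
Qed.

Lemma expansionZ N (z : R[i]) (c : 'cV[R[i]]_N) :
  expansion p (z *: c) = z *: expansion p c.
Proof.
by rewrite /expansion scaler_sumr; apply: eq_bigr => i _; rewrite mxE scalerA.
Qed.

(** The basis polynomials have distinct degrees, so the top coefficient
    vanishes first. *)
Lemma expansion_inj N (c : 'cV[R[i]]_N) : expansion p c = 0 -> c = 0.
Proof.
elim: N c => [|N ih] c; first by move=> _; apply/colP => -[].
rewrite /expansion big_ord_recr/= => E.
have cN : c ord_max 0 = 0.
  have := congr1 (fun q : {poly R[i]} => q`_N) E.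
  rewrite coef0 coefD coefZ coef_map [X in X + _]nth_default ?add0r; last first.
    apply: (leq_trans (size_sum _ _ _)); apply/bigmax_leqP => i _.
    by rewrite (leq_trans (size_scale_leq _ _))// size_map_poly sp.
  move=> /eqP; rewrite mulf_eq0 => /orP[/eqP//|].
  have -> : (p N)`_N = lead_coef (p N) by rewrite lead_coefE sp.
  by rewrite fmorph_eq0 lead_coef_eq0 -size_poly_eq0 sp.
move: E; rewrite cN scale0r addr0 => E.
apply/colP => i; rewrite mxE.
have [->//|iN] := eqVneq i ord_max.
have iN' : (i < N)%N.
  by have := ltn_ord i; rewrite ltnS leq_eqVlt => /predU1P[iE|//];
    case/negP: iN; apply/eqP/val_inj.
have : \col_i c (widen_ord (leqnSn N) i) 0 = 0.
  by apply: ih; rewrite -[RHS]E; apply: eq_bigr => j _; rewrite mxE.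
move=> /colP/(_ (Ordinal iN')); rewrite !mxE => <-.
by congr (c _ _); exact/val_inj.
Qed.

(** Equality of dimensions is a hypothesis rather than a conversion because
    the collocation system has k + (N - k) rows and N columns. *)
Lemma linear_inj_surj (F : fieldType) (m n : nat) (f : 'cV[F]_n -> 'cV[F]_m) :
  m = n -> linear f -> (forall c, f c = 0 -> c = 0) -> forall d, exists c, f c = d.
Proof.
move=> mn; subst m => lf finj d.
pose M : 'M[F]_n := \matrix_(i, j) f (delta_mx j 0) i 0.
have f0 : f 0 = 0.
  by have := lf (-1) 0 0; rewrite scaleN1r oppr0 add0r scaleN1r addNr.
have fM c : f c = M *m c.
  have fsum (s : seq 'I_n) : f (\sum_(j <- s) c j 0 *: delta_mx j 0) =
      \sum_(j <- s) c j 0 *: f (delta_mx j 0).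
    elim: s => [|j s ih]; first by rewrite !big_nil.
    by rewrite !big_cons lf ih.
  have cE : c = \sum_j c j 0 *: delta_mx j 0.
    rewrite {1}[c]matrix_sum_delta; apply: eq_bigr => j _.
    by rewrite big_ord1.
  rewrite {1}cE fsum; apply/colP => i; rewrite summxE mxE.
  by apply: eq_bigr => j _; rewrite !mxE mulrC.
have uM : M \in unitmx by apply: unitmx_inj => c; rewrite -fM; exact: finj.
by exists (invmx M *m d); rewrite fM mulKVmx.
Qed.

Lemma polyfunD (q1 q2 : {poly R[i]}) l x :
  polyfun (q1 + q2) l x = polyfun q1 l x + polyfun q2 l x.
Proof. by rewrite /polyfun derivnD hornerD. Qed.

Lemma polyfunZ (z : R[i]) (q : {poly R[i]}) l x :
  polyfun (z *: q) l x = z * polyfun q l x.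
Proof. by rewrite /polyfun derivnZ hornerZ. Qed.

Lemma poly_eq0_II (q : {poly R[i]}) : (forall x, II x -> polyfun q 0 x = 0) -> q = 0.
Proof.
move=> q0; pose s := [seq ((n.+1%:R)^-1 : R)%:C | n <- iota 0 (size q)].
apply: (@roots_geq_poly_eq0 _ _ s).
- apply/allP => _ /mapP[n _ ->]; rewrite rootE -polyfun0 q0//.
  apply/II_itv; apply/andP; split.
    by rewrite (@le_trans _ _ (0 : R))// ?invr_ge0//; lra.
  by rewrite invf_le1 ?ltr0n// ler1n.
- rewrite map_inj_uniq ?iota_uniq// => m n /complexI/invr_inj/eqP.
  by rewrite eqr_nat eqSS => /eqP.
- by rewrite size_map size_iota.
Qed.

Lemma size_derivn_le (q : {poly R[i]}) N k : (size q <= N)%N ->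
  (size q^`(k) <= N - k)%N.
Proof.
move=> sq; apply/leq_sizeP => j jN; rewrite coef_derivn nth_default ?mul0rn//.
by rewrite (leq_trans sq)// -leq_subLR.
Qed.

Lemma polyfun_derivn (q : {poly R[i]}) l x : polyfun q^`(l) 0 x = polyfun q l x.
Proof. by []. Qed.

End Collocation.

(** * Error estimate *)

Section Residual.
Context {R : realType} (k : nat) (a : nat -> R -> R[i]) (S T : 'M[R[i]]_k).
Variables (alpha b : R).
Hypothesis b0 : 0 < b.
Hypothesis balpha : b <= alpha.
Hypothesis alpha1 : alpha <= 1.
Hypothesis b2 : b <= 2^-1.
Hypothesis ha : forall j, (j < k)%N -> hoelder_fun alpha (a j).
Hypothesis uniq : forall u, Ck k u ->
  (forall x, II x -> lower_order k a u x + u k x = 0) -> boundary_form S T u = 0 ->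
  forall x, II x -> u 0%N x = 0.

(** The operator vanishes at the nodes, so the interpolants of A v and of
    v^(k) are opposite, and interpolation reproduces the k-th derivative of E.
    *)
Lemma collocation_residual N (P : 'I_(N - k) -> R) (E : {poly R[i]})
    (u : nat -> R -> R[i]) x :
  injective P -> (size E <= N)%N ->
  let v l y := polyfun E l y - u l y in
  (forall r, lower_order k a v (P r) + v k (P r) = 0) ->
  lower_order k a v x + v k x =
    (lower_order k a v x - polyfun (interp P (lower_order k a v)) 0 x) +
    - (u k x - polyfun (interp P (u k)) 0 x).
Proof.
move=> Pinj sE v hv.
have e1 : interp P (lower_order k a v) = interp P (u k) - E^`(k).
  rewrite -(interp_poly Pinj (size_derivn_le k sE)) -interpB.
  apply: eq_interp => r; have := hv r; rewrite /v polyfun_derivn => /eqP.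
  by rewrite addr_eq0 opprB => /eqP.
have e2 : (E^`(k)).[x%:C] = polyfun E k x by [].
have vE : v k x = polyfun E k x - u k x by [].
rewrite e1 !polyfun0 hornerD hornerN e2 vE.
move: (lower_order k a v x) => z; ring.
Qed.

(** The residual identity bounds the L2 norm G of the operator applied to v by
    2 r plus a multiple of (1 + Lebesgue constant) (N - k)^-b times G, which
    is absorbed by the left side under the smallness condition. *)
Lemma collocation_bound : exists C M : R, [/\ 0 < C, 0 < M &
  forall N (P : 'I_(N - k) -> R) (E : {poly R[i]}) (u : nat -> R -> R[i]),
  (0 < N - k)%N -> injective P -> (forall r, II (P r)) ->
  M * ((1 + lebesgue_const P) * ((N - k)%:R `^ b)^-1) <= 1 ->
  (size E <= N)%N -> Ck k u ->
  let v l y := polyfun E l y - u l y in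
  (forall r, lower_order k a v (P r) + v k (P r) = 0) -> boundary_form S T v = 0 ->
  let r := L2norm (fun x => u k x - polyfun (interp P (u k)) 0 x) in
  Hnorm k v <= C * r /\
  forall j, (j < k)%N -> forall x, II x -> normc (v j x) <= C * r].
Proof.
have [C1 C10 hC1] := full_stability b0 balpha ha uniq.
have [H H0 hH] := lower_order_hoelder b0 balpha alpha1 b2 ha.
have C10' := ltW C10.
exists (4 * C1 + 2 * k.+1%:R * (4 * C1)), (136 * H * C1 + 1); split.
- by apply: addr_gt0; rewrite ?mulr_gt0.
- by apply: ltr_wpDl => //; do 2 apply: mulr_ge0 => //; rewrite mulr_ge0.
move=> N P E u n0 Pinj PI small sE cu v hv bv r.
have cv : Ck k v by exact: (CkB (Ck_polyfun k E) cu).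
have := hC1 v cv bv; set G := L2norm _ => -[vj vk].
have G0 : 0 <= G by exact: L2norm_ge0.
have r0 : 0 <= r by exact: L2norm_ge0.
have D0 : 0 <= C1 * G by exact: mulr_ge0.
have hl := hH v (C1 * G) cv vj vk.
have b01 : 0 <= b <= 1 by rewrite (ltW b0)/=; have := b2; lra.
have ca := coef_cts b0 balpha ha.
have [cv1 _] := cv; have [cu1 _] := cu.
have cl := cts_lower_order ca (fun j jk => cv1 j (ltnW jk)).
have err x := @interp_error R _ P Pinj PI _ _ b x n0 b01 (mulr_ge0 H0 D0) cl hl.
set L := 1 + lebesgue_const P in err small.
have L0 : 0 <= L by rewrite addr_ge0// lebesgue_const_ge0.
set w := ((N - k)%:R `^ b)^-1 in err small.
have w0 : 0 <= w by rewrite invr_ge0 powR_ge0.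
have ce : cts (fun x => lower_order k a v x - polyfun (interp P (lower_order k a v)) 0 x).
  exact: (ctsB cl (@cts_polyfun R _ 0)).
have cr : cts (fun x => u k x - polyfun (interp P (u k)) 0 x).
  exact: (ctsB (cu1 k (leqnn k)) (@cts_polyfun R _ 0)).
have Lw0 : 0 <= L * (17 * (H * (C1 * G)) * w).
  by do ?[apply: mulr_ge0 => //].
have eG := L2norm_le_sup ce Lw0 err.
have rN : L2norm (fun x => - (u k x - polyfun (interp P (u k)) 0 x)) = r.
  congr (Num.sqrt _); apply: eq_Rintegral => x _; by rewrite normcN.
have GE : G <= 2 * (2 * (L * (17 * (H * (C1 * G)) * w)) + r).
  have GE0 : G = L2norm (fun x =>
      (lower_order k a v x - polyfun (interp P (lower_order k a v)) 0 x) +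
      - (u k x - polyfun (interp P (u k)) 0 x)).
    by apply: eq_L2norm => x Ix; exact: collocation_residual.
  rewrite [leLHS]GE0 (le_trans (L2normD ce (ctsN cr)))// rN ler_wpM2l// lerD2r.
  exact: eG.
(* absorption *)
have hG : G <= 4 * r.
  have e1 : 2 * (2 * (L * (17 * (H * (C1 * G)) * w)) + r) =
     2^-1 * (136 * H * C1 * (L * w)) * G + 2 * r by field.
  have e2 : 136 * H * C1 * (L * w) <= 1.
    apply: le_trans small; rewrite [leRHS]mulrDl lerDl mul1r; exact: mulr_ge0.
  have e3 : 136 * H * C1 * (L * w) * G <= 1 * G by apply: ler_wpM2r.
  rewrite e1 -mulrA in GE.
  clear -GE e3 G0 r0; move: (136 * H * C1 * (L * w) * G) GE e3 => z.
  move: G0; rewrite /r /G in r0 *.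
  move: (L2norm _) => G' G0; move: (L2norm _) r0 => r' r0 GE e3; lra.
have C1G : C1 * G <= 4 * C1 * r.
  by rewrite [4 * C1]mulrC -mulrA ler_wpM2l.
split.
  apply: (le_trans (Hnorm_le cv vj vk)).
  apply: (@le_trans _ _ (2 * k.+1%:R * (4 * C1 * r))).
    by rewrite ler_wpM2l// mulr_ge0.
  have -> : (4 * C1 + 2 * k.+1%:R * (4 * C1)) * r =
    4 * C1 * r + 2 * k.+1%:R * (4 * C1 * r) by clear; ring.
  by rewrite lerDr mulr_ge0// mulr_ge0.
move=> j jk x Ix; rewrite (le_trans (vj j jk x Ix))// (le_trans C1G)//.
by rewrite [leRHS]mulrDl lerDl !mulr_ge0.
Qed.

End Residual.

(** * Convergence *)

Section Asymptotics.
Context {R : realType}.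

(** For large N one has N <= 2 (N - k), so passing from N to N - k costs a
    factor 2. *)
Lemma lebesgue_rate (k : nat) (alpha b : R) (P : forall n : nat, 'I_n -> R) :
  0 < b -> b <= 1 -> Num.min alpha 2^-1 = b ->
  (fun N : nat => lebesgue_const (P (N - k)%N) : R^o) =o_\oo
     (fun N : nat => Num.min (N%:R `^ alpha) (N%:R `^ 2^-1) : R^o) ->
  forall e, 0 < e -> \forall N \near \oo,
    (0 < N - k)%N /\
    (1 + lebesgue_const (P (N - k)%N)) * ((N - k)%:R `^ b)^-1 <= e.
Proof.
move=> b0 b1 bE /eqoP hL e e0.
have e40 : 0 < e / 4 by rewrite divr_gt0.
have {}hL := hL _ e40.
(* beyond Z the constant 1 is itself below e / 4 * N^b *)
pose Z : R := ((e / 4)^-1) `^ b^-1.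
near=> N.
have kN : (k.*2.+1 <= N)%N by near: N; exact: nbhs_infty_ge.
have ZN : Z <= N%:R by near: N; exact: nbhs_infty_ger.
have hN : `|lebesgue_const (P (N - k)%N)| <=
    e / 4 * `|Num.min (N%:R `^ alpha) (N%:R `^ 2^-1)| by near: N; exact: hL.
have n0 : (0 < N - k)%N by clear -kN; lia.
have N0' : (0 < N)%N by clear -kN; lia.
have Nle : (N <= 2 * (N - k))%N by clear -kN; lia.
split=> //.
have N0 : 0 < N%:R :> R by rewrite ltr0n.
have np : 0 < (N - k)%:R :> R by rewrite ltr0n.
have wN0 : 0 < N%:R `^ b by exact: powR_gt0.
have wn0 : 0 < (N - k)%:R `^ b by exact: powR_gt0.
have minE : `|Num.min (N%:R `^ alpha) (N%:R `^ 2^-1)| <= N%:R `^ b.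
  rewrite ger0_norm; last by rewrite le_min !powR_ge0.
  rewrite -bE; case: (leP alpha 2^-1) => _; by rewrite ge_min lexx ?orbT.
have LN : lebesgue_const (P (N - k)%N) <= e / 4 * N%:R `^ b.
  rewrite (le_trans (ler_norm _))// (le_trans hN)// ler_wpM2l// ltW//.
have oneN : 1 <= e / 4 * N%:R `^ b.
  rewrite -ler_pdivrMl// mulr1.
  have -> : (e / 4)^-1 = Z `^ b.
    by rewrite /Z -powRrM mulVf ?gt_eqF// powRr1// invr_ge0 ltW.
  by apply: ge0_ler_powR => //; rewrite ?nnegrE ?powR_ge0// ltW.
have Nn : N%:R `^ b <= 2 * (N - k)%:R `^ b.
  apply: (@le_trans _ _ ((2 * (N - k)%:R) `^ b)).
    apply: ge0_ler_powR; rewrite ?nnegrE ?(ltW b0) ?(ltW N0)//.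
    by rewrite -natrM ler_nat.
  rewrite powRM// ler_wpM2r ?powR_ge0// -[leRHS](@powRr1 R 2)//.
  by rewrite ler_powR//; lra.
rewrite ler_pdivrMr//.
have e4 : e / 4 * N%:R `^ b <= e / 4 * (2 * (N - k)%:R `^ b).
  by rewrite ler_wpM2l// ltW.
lra.
Unshelve. all: by end_near. Qed.

End Asymptotics.

Theorem theoremA1 (R : realType) (k : nat) (hk : (1 <= k)%N)
  (S T : 'M[R[i]]_k) (b : 'cV[R[i]]_k)
  (alpha : R) (halpha : 0 < alpha <= 1)
  (a : nat -> R -> R[i]) (f : R -> R[i])
  (hak : forall x, II x -> a k x = 1)
  (ha : forall j, (j < k)%N -> hoelder_fun alpha (a j))
  (hf : hoelder_fun alpha f)
  (hlead : uniquely_solvable (leading_coef k a) S T)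
  (hfull : uniquely_solvable a S T)
  (lambda : R) (hlambda : 0 <= lambda)
  (p : nat -> {poly R}) (hp : orthonormal_polys lambda p)
  (P : forall n : nat, 'I_n -> R)
  (hPinj : forall n, injective (P n))
  (hPI : forall n (i : 'I_n), II (P n i))
  (hLambda : (fun N : nat => lebesgue_const (P (N - k)%N) : R^o) =o_\oo
     (fun N : nat => Num.min (N%:R `^ alpha) (N%:R `^ 2^-1) : R^o)) :
  exists u : nat -> R -> R[i],
    [/\ sobolev k u, cts (u k), bvp_solution a S T b f u &
        forall v : nat -> R -> R[i], sobolev k v ->
          bvp_solution a S T b f v -> forall x, II x -> v 0%N x = u 0%N x] /\
    exists (C : R) (c : forall N : nat, 'cV[R[i]]_N),
      (\forall N \near \oo,
        [/\ collocation a S T b f p (P (N - k)%N) (c N),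
            forall c' : 'cV[R[i]]_N,
              collocation a S T b f p (P (N - k)%N) c' -> c' = c N &
            Hnorm k (fun l x => polyfun (expansion p (c N)) l x - u l x) <=
            C * L2norm (fun x =>
                  u k x - polyfun (interp (P (N - k)%N) (u k)) 0 x)]) /\
      (fun N : nat =>
         Hnorm k (fun l x => polyfun (expansion p (c N)) l x - u l x))
        @ \oo --> (0 : R).

Proof.
have /andP[alpha0 alpha1] := halpha.
pose beta := Num.min alpha 2^-1.
have beta0 : 0 < beta by rewrite lt_min alpha0/= invr_gt0.
have betaalpha : beta <= alpha by rewrite ge_min lexx.
have beta2 : beta <= 2^-1 by rewrite ge_min lexx orbT.
have beta1 : beta <= 1 by exact: le_trans betaalpha alpha1.
have ca := coef_cts beta0 betaalpha ha.
have cf := hoelder_cts alpha0 hf.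
have uniq u : Ck k u -> (forall x, II x -> lower_order k a u x + u k x = 0) ->
    boundary_form S T u = 0 -> forall x, II x -> u 0%N x = 0.
  move=> cu Lu Bu; apply: (hfull u (Ck_sobolev cu) _); split=> //.
  apply: aeW => x /andP[x1 x2].
  have Ix : II x by apply/II_itv; lra.
  by rewrite (diffopE u (hak x Ix)) Lu.
have [u [cu Lu Bu]] := bvp_exists ca uniq b cf.
have [cu1 _] := cu.
have Lu' x : II x -> diffop k a u x = f x.
  by move=> Ix; rewrite (diffopE u (hak x Ix)) Lu.
exists u; split.
  split.
  - exact: Ck_sobolev.
  - exact: (cu1 k).
  - split=> //; apply: aeW => x /andP[x1 x2].
    by apply: Lu'; apply/II_itv; lra.
  - move=> v sv [Lv Bv] x Ix; apply/eqP; rewrite -subr_eq0; apply/eqP.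
    apply: (hfull _ (sobolevB sv (Ck_sobolev cu)) _ x Ix); split; last first.
      have -> : 0 = boundary_form S T v - boundary_form S T u by rewrite [boundary_form S T v]Bv Bu subrr.
      exact: boundary_formB.
    apply: (@filterS _ _ (ae_filter_ringOfSetsType (@lebesgue_measure R)) _ _ _ Lv).
    move=> y {}Lv y1.
    have Iy : II y by move/andP: y1 => [? ?]; apply/II_itv; lra.
    rewrite -(subrr (f y)) -{1}(Lv y1) -(Lu' y Iy) /diffop -sumrB.
    by apply: eq_bigr => j _; rewrite mulrBr.
have [C [M [C0 M0 hC]]] :=
  collocation_bound beta0 betaalpha alpha1 beta2 ha uniq.
have [sp _] := hp.
pose good N := (0 < N - k)%N /\
  M * ((1 + lebesgue_const (P (N - k)%N)) * ((N - k)%:R `^ beta)^-1) <= 1.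
(* the error estimate for the exact solution zero, whose right-hand side vanishes *)
have inj0 N (c : 'cV[R[i]]_N) : good N ->
    collocation a S T 0 (fun=> 0) p (P (N - k)%N) c -> c = 0.
  move=> [n0 small] [B0 c0].
  pose z (l : nat) (x : R) : R[i] := 0.
  have cz : Ck k z.
    rewrite (_ : z = polyfun 0); first exact: Ck_polyfun.
    by apply/funext => l; apply/funext => x; rewrite /polyfun linear0 horner0.
  have vE : (fun l y => polyfun (expansion p c) l y - z l y) =
      polyfun (expansion p c).
    by apply/funext => l; apply/funext => y; rewrite subr0.
  have [||_ hz] := hC N _ (expansion p c) z n0 (@hPinj _) (@hPI _) small
    (size_expansion sp c) cz.
  - move=> r; have h := c0 r.
    by rewrite (diffopE _ (hak _ (hPI _ r))) in h; rewrite -[RHS]h vE subr0.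
  - by rewrite vE.
  apply: (expansion_inj sp); apply: poly_eq0_II => x Ix.
  have := hz 0%N hk x Ix; rewrite subr0.
  have -> : L2norm (fun x => z k x - polyfun (interp (P (N - k)%N) (z k)) 0 x) = 0.
    apply/eqP; rewrite eq_le L2norm_ge0 andbT.
    have E0 y : II y -> z k y - polyfun (interp (P (N - k)%N) (z k)) 0 y = 0.
      move=> _; rewrite (@eq_interp _ _ _ (z k) (fun y => 0 * z k y)); last first.
        by move=> i; rewrite mul0r.
      by rewrite interpZ scale0r polyfun0 horner0 subrr.
    rewrite (eq_L2norm (g2 := fun=> 0) E0).
    have := @L2norm_le_sup R (fun=> 0) 0 (@cts_cst R 0) (lexx 0).
    rewrite mulr0; apply=> y _.
    by rewrite ComplexField.Normc.normc0.
  by rewrite mulr0; exact: normc_eq0.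
have coll_sub N (c1 c2 : 'cV[R[i]]_N) :
    collocation a S T b f p (P (N - k)%N) c1 ->
    collocation a S T b f p (P (N - k)%N) c2 ->
    collocation a S T 0 (fun=> 0) p (P (N - k)%N) (c1 - c2).
  move=> [B1 L1] [B2 L2].
  have eE : polyfun (expansion p (c1 - c2)) =
      (fun l x => polyfun (expansion p c1) l x - polyfun (expansion p c2) l x).
    apply/funext => l; apply/funext => x.
    by rewrite -scaleN1r expansionD expansionZ polyfunD polyfunZ mulN1r.
  split.
    have -> : 0 = boundary_form S T (polyfun (expansion p c1)) -
        boundary_form S T (polyfun (expansion p c2)).
      by rewrite [boundary_form S T (polyfun (expansion p c1))]B1
        [boundary_form S T (polyfun (expansion p c2))]B2 subrr.
    by rewrite eE; exact: boundary_formB.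
  move=> r; rewrite eE -(subrr (f (P (N - k)%N r))) -{1}(L1 r) -(L2 r).
  by rewrite /diffop -sumrB; apply: eq_bigr => j _; rewrite mulrBr.
have coll_ex N : good N -> exists c : 'cV[R[i]]_N,
    collocation a S T b f p (P (N - k)%N) c.
  move=> gN; have [n0 _] := gN.
  have kN : (k + (N - k) = N)%N by rewrite subnKC// ltnW// -subn_gt0.
  (* boundary rows on top of collocation rows *)
  pose Phi (c : 'cV[R[i]]_N) : 'cV[R[i]]_(k + (N - k)) :=
    col_mx (boundary_form S T (polyfun (expansion p c)))
      (\col_r diffop k a (polyfun (expansion p c)) (P (N - k)%N r)).
  have Philin : linear Phi.
    move=> s c1 c2; rewrite /Phi scale_col_mx add_col_mx.
    have eE : polyfun (expansion p (s *: c1 + c2)) =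
        (fun l x => s * polyfun (expansion p c1) l x + polyfun (expansion p c2) l x).
      apply/funext => l; apply/funext => x.
      by rewrite expansionD expansionZ polyfunD polyfunZ.
    congr col_mx; first by rewrite eE boundary_formD boundary_formZ.
    apply/colP => r; rewrite !mxE eE /diffop mulr_sumr -big_split.
    by apply: eq_bigr => j _; rewrite /= mulrDr mulrCA.
  have Phi0 c : Phi c = 0 -> c = 0.
    move=> c0; have : Phi c = col_mx 0 0 by rewrite c0 col_mx0.
    move=> /eq_col_mx[h1 h2].
    apply: (inj0 N c gN); split; first exact: h1.
    by move=> r; move/colP/(_ r): h2; rewrite !mxE.
  have [c hc] := linear_inj_surj kN Philin Phi0
    (col_mx b (\col_r f (P (N - k)%N r))).
  exists c; move/eq_col_mx: hc => [h1 h2]; split; first exact: h1.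
  by move=> r; move/colP/(_ r): h2; rewrite !mxE.
have ex_cc N : exists c : 'cV[R[i]]_N, good N ->
    collocation a S T b f p (P (N - k)%N) c.
  case: (pselect (good N)) => [/coll_ex[c hc]|ng]; first by exists c.
  by exists 0.
(* outside the good range the coefficients are arbitrary *)
pose cc N := projT1 (cid (ex_cc N)).
have hcc N : good N -> collocation a S T b f p (P (N - k)%N) (cc N).
  exact: (projT2 (cid (ex_cc N))).
have bound N : good N ->
    Hnorm k (fun l x => polyfun (expansion p (cc N)) l x - u l x) <=
    C * L2norm (fun x => u k x - polyfun (interp (P (N - k)%N) (u k)) 0 x).
  move=> gN; have [n0 small] := gN; have [B1 L1] := hcc N gN.
  have [||//] := hC N _ (expansion p (cc N)) u n0 (@hPinj _) (@hPI _) small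
    (size_expansion sp (cc N)) cu.
  - move=> r; rewrite -(@diffopE _ k a
      (fun l x => polyfun (expansion p (cc N)) l x - u l x) _ (hak _ (hPI _ r))).
    rewrite -(subrr (f (P (N - k)%N r))) -{1}(L1 r) -(Lu' _ (hPI _ r)) /diffop -sumrB.
    by apply: eq_bigr => j _; rewrite mulrBr.
  - by rewrite boundary_formB [boundary_form S T (polyfun _)]B1 Bu subrr.
have rate := lebesgue_rate beta0 beta1 erefl hLambda.
have near_good : \forall N \near \oo, good N.
  have Mi : 0 < M^-1 by rewrite invr_gt0.
  apply: filterS (rate _ Mi) => N [n0 h]; split=> //.
  by rewrite mulrC -ler_pdivlMr// mul1r.
exists C, cc; split.
  apply: filterS near_good => N gN; split; [exact: hcc| |exact: bound].
  move=> c' hc'; apply/eqP; rewrite -subr_eq0; apply/eqP.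
  by apply: (inj0 N _ gN); apply: coll_sub => //; exact: hcc.
have [D D0 hD] : exists2 D, 0 <= D &
    (forall j, (j < k)%N -> forall x, II x -> normc (u j x) <= D) /\
    L2norm (u k) <= D.
  have [B B0 hB] := coef_bound (fun j (jk : (j < k)%N) => cu1 j (ltnW jk)).
  exists (B + L2norm (u k)); first by rewrite addr_ge0 ?L2norm_ge0// ltW.
  split=> [j jk x Ix|]; last by rewrite lerDr ltW.
  by rewrite (le_trans (hB j jk x Ix))// lerDl L2norm_ge0.
have [H1 H10 hH1] := hoelder_lower beta0 betaalpha alpha1 hf.
have [H2 H20 hH2] := lower_order_hoelder beta0 betaalpha alpha1 beta2 ha.
pose H := H1 + H2 * D.
have H0 : 0 <= H by rewrite addr_ge0// mulr_ge0.
(* regularity of the exact solution, read off the equation *)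
have uk_hoelder x y : II x -> II y ->
    normc (u k x - u k y) <= H * `|x - y| `^ beta.
  move=> Ix Iy.
  have ukE z : II z -> u k z = f z - lower_order k a u z.
    by move=> Iz; rewrite -(Lu z Iz) addrAC subrr add0r.
  have -> : u k x - u k y = (f x - f y) - (lower_order k a u x - lower_order k a u y).
    by rewrite !ukE//; ring.
  rewrite (le_trans (normcB _ _))// mulrDl lerD ?hH1//.
  exact: (hH2 u D cu hD.1 hD.2).
apply/cvgrPdist_le => e e0.
pose K := 2 * 17 * H * C + 1.
have K0 : 0 < K by rewrite ltr_wpDl// !mulr_ge0// ltW.
have eK : 0 < e / K by exact: divr_gt0.
near=> N.
have gN : good N by near: N.
have [n0 hN] : (0 < N - k)%N /\ (1 + lebesgue_const (P (N - k)%N)) *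
   ((N - k)%:R `^ beta)^-1 <= e / K by near: N; exact: rate.
rewrite sub0r normrN ger0_norm ?sqrtr_ge0// (le_trans (bound N gN))//.
set L := 1 + lebesgue_const (P (N - k)%N) in hN.
set w := ((N - k)%:R `^ beta)^-1 in hN.
have L0 : 0 <= L by rewrite addr_ge0// lebesgue_const_ge0//; exact: hPI.
have w0 : 0 <= w by rewrite invr_ge0 powR_ge0.
have b01 : 0 <= beta <= 1 by rewrite ltW.
have err x := @interp_error R _ (P (N - k)%N) (@hPinj _) (@hPI _) _ _ beta x n0
  b01 H0 (cu1 k (leqnn k)) uk_hoelder.
have ce := ctsB (cu1 k (leqnn k))
  (@cts_polyfun R (interp (P (N - k)%N) (u k)) 0).
have Lw0 : 0 <= L * (17 * H * w) by do ?[apply: mulr_ge0 => //].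
have h1 := L2norm_le_sup ce Lw0 err.
apply: (@le_trans _ _ (C * (2 * (L * (17 * H * w))))).
  by rewrite ler_wpM2l// ltW.
have -> : C * (2 * (L * (17 * H * w))) = 2 * 17 * H * C * (L * w) by ring.
have KLw : K * (L * w) <= e by rewrite mulrC -ler_pdivlMr.
apply: le_trans KLw; rewrite /K [leRHS]mulrDl lerDl mul1r; exact: mulr_ge0.
Unshelve. all: by end_near. Qed.
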